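(* Let $\mathbb{K}$ be a field, let $m\ge2$, let $\underline{\ell}=(\ell_1,\ldots,\ell_m)$ be an integer vector with $\ell_i\ge1$ for all $i$, and let $G=\mathbf{G}_{2\underline{\ell}+1}$ be the multi-path graph of odd type with paths of lengths $2\ell_1+1,\ldots,2\ell_m+1$. For $i\ge1$ and $j\ge1$ let \[ O_i^j=\{(k_1,\ldots,k_{i+1},r)\mid \ell_{k_1}+\cdots+\ell_{k_{i+1}}+r=j,\ 1\le k_1<\cdots<k_{i+1}\le m,\ 1\le r\le i\} \] (so $O_i^j=\emptyset$ for $i\ge m$). Then there is a monomial order $<$ on $\mathbb{K}[E(G)]$ such that $\mathrm{in}_<(I_G)$ is square-free and \[ \beta_{i,j}(\mathbb{K}[G])=\beta_{i,j}\bigl(\mathbb{K}[E(G)]/\mathrm{in}_<(I_G)\bigr)=|O_i^j|\qquad\text{for all } i\ge1,\ j\ge1. \]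
   Context: For a finite simple graph $G$ with vertex set $V(G)$ and edge set $E(G)$, $\mathbb{K}[V(G)]$ and $\mathbb{K}[E(G)]$ are the polynomial rings with variables the vertices, respectively the edges, of $G$. The toric ideal $I_G$ is the kernel of $\phi:\mathbb{K}[E(G)]\to\mathbb{K}[V(G)]$, $e=\{x,y\}\mapsto xy$, and the edge ring is $\mathbb{K}[G]=\mathrm{im}\,\phi\cong\mathbb{K}[E(G)]/I_G$. Each edge variable has degree $1$, and $\beta_{i,j}(M)=\dim_{\mathbb{K}}\mathrm{Tor}_i^{\mathbb{K}[E(G)]}(M,\mathbb{K})_j$. $\mathbf{G}_{2\underline{\ell}+1}$ is the simple graph consisting of $m$ paths of lengths (numbers of edges) $2\ell_1+1,\ldots,2\ell_m+1$, all starting at a common vertex $v_1$ and ending at a common vertex $v_2\ne v_1$, and pairwise having no common vertices except $v_1,v_2$. *)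

(* Defs.v *)
From HB Require Import structures.
From mathcomp Require Import all_boot all_order all_algebra.
From mathcomp Require Export mpoly.

Set Implicit Arguments.
Unset Strict Implicit.
Unset Printing Implicit Defensive.

Import GRing.Theory.
Local Open Scope ring_scope.

Record sgraph := SGraph {
  vertex : finType;
  adj : rel vertex;
  adj_sym : ssrbool.symmetric adj;
  adj_irrefl : irreflexive adj
}.

Definition edges (G : sgraph) : {set {set vertex G}} :=
  [set [set p.1; p.2] | p : vertex G * vertex G & adj p.1 p.2].

(* Variables are indexed by 'I_#|edges G| and 'I_#|vertex G| through the
   canonical enumerations [enum_val] and [enum_rank]. *)
Notation edge_poly_ring K G := {mpoly K[#|edges G|]} (only parsing).
Notation vertex_poly_ring K G := {mpoly K[#|vertex G|]} (only parsing).

Definition edge_map (K : fieldType) (G : sgraph) (p : edge_poly_ring K G) :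
    vertex_poly_ring K G :=
  p \mPo [tuple \prod_(x in enum_val e) 'X_(enum_rank x) | e < #|edges G|].

(* Ideals are represented by their membership predicates. *)
Definition toric_ideal (K : fieldType) (G : sgraph) (p : edge_poly_ring K G) :
    Prop :=
  edge_map p = 0.

(* [lem u v] reads: u is smaller than or equal to v. *)
Definition monomial_order (n : nat) (lem : rel 'X_{1..n}) : Prop :=
  [/\ reflexive lem, ssrbool.antisymmetric lem, transitive lem & total lem] /\
  (forall u, lem 0%MM u) /\
  (forall u v w, lem u v -> lem (u + w)%MM (v + w)%MM).

Definition ideal_span (S : comNzRingType) (A : S -> Prop) (p : S) : Prop :=
  exists s : seq (S * S),
    (forall cg, cg \in s -> A cg.2) /\ p = \sum_(cg <- s) cg.1 * cg.2.

Definition is_lead_monomial (K : fieldType) (n : nat) (lem : rel 'X_{1..n})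
    (p : {mpoly K[n]}) (u : 'X_{1..n}) : Prop :=
  u \in msupp p /\ forall v, v \in msupp p -> lem v u.

(* The zero polynomial has empty support, hence no leading monomial. *)
Definition initial_ideal (K : fieldType) (n : nat) (lem : rel 'X_{1..n})
    (I : {mpoly K[n]} -> Prop) : {mpoly K[n]} -> Prop :=
  ideal_span (fun q => exists p u,
    [/\ I p, is_lead_monomial lem p u & q = 'X_[u]]).

Definition squarefree_monomial_ideal (K : fieldType) (n : nat)
    (I : {mpoly K[n]} -> Prop) : Prop :=
  exists B : 'X_{1..n} -> Prop,
    (forall u, B u -> forall x : 'I_n, (u x <= 1)%N) /\
    (forall p, I p <-> ideal_span (fun q => exists2 u, B u & q = 'X_[u]) p).

(* For S = K[x_1, ..., x_n], a complex ... -> F_1 -> F_0 -> S, with F_i the free module of rank [cx_rank i] whose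
   k-th basis element has degree [cx_deg k].  Elements of F_i are row vectors,
   on which the differentials act by multiplication on the right.  [cx_aug]
   lifts the augmentation F_0 -> S/I to S. *)
Record free_complex (K : fieldType) (n : nat) := FreeComplex {
  cx_rank : nat -> nat;
  cx_deg : forall i, 'I_(cx_rank i) -> nat;
  cx_diff : forall i, 'M[{mpoly K[n]}]_(cx_rank i.+1, cx_rank i);
  cx_aug : 'cV[{mpoly K[n]}]_(cx_rank 0)
}.

(* F is a resolution of S/I by finitely generated graded free S-modules, with
   homogeneous maps of degree 0. *)
Definition graded_free_resolution (K : fieldType) (n : nat)
    (I : {mpoly K[n]} -> Prop) (F : free_complex K n) : Prop :=
  [/\ (forall k u, u \in msupp (cx_aug F k 0) -> mdeg u = cx_deg k)
      /\ (forall i k k' u, u \in msupp (cx_diff F i k k') ->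
            (mdeg u + cx_deg k')%N = cx_deg k),
      (forall p : {mpoly K[n]}, exists w : 'rV_(cx_rank F 0),
         I ((w *m cx_aug F) 0 0 - p)),
      (forall w : 'rV_(cx_rank F 0), I ((w *m cx_aug F) 0 0) <->
         exists w' : 'rV_(cx_rank F 1), w = w' *m cx_diff F 0)
    & (forall i (w : 'rV_(cx_rank F i.+1)), w *m cx_diff F i = 0 <->
         exists w' : 'rV_(cx_rank F i.+2), w = w' *m cx_diff F i.+1)].

Section TensorWithResidueField.
Variables (K : fieldType) (n : nat) (F : free_complex K n).

(* K = S/(x_1, ..., x_n), so tensoring with K keeps the constant terms. *)
Definition residue_diff (i : nat) : 'M[K]_(cx_rank F i.+1, cx_rank F i) :=
  map_mx (mcoeff 0%MM) (cx_diff F i).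

(* The row space is the degree j component of F_i (x) K. *)
Definition degree_part (i j : nat) : 'M[K]_(cx_rank F i) :=
  diag_mx (\row_k (cx_deg k == j)%:R).

Definition cycles (i j : nat) : 'M[K]_(cx_rank F i) :=
  match i with
  | 0 => degree_part 0 j
  | i'.+1 => (degree_part i'.+1 j :&: kermx (residue_diff i'))%MS
  end.

Definition boundaries (i j : nat) : 'M[K]_(cx_rank F i.+1, cx_rank F i) :=
  degree_part i.+1 j *m residue_diff i.

(* The dimension of H_i(F (x) K)_j; no truncation occurs when F is a graded
   complex, as the boundaries are then contained in the cycles. *)
Definition tor_dim (i j : nat) : nat :=
  (\rank (cycles i j) - \rank (boundaries i j))%N.

End TensorWithResidueField.

(* The i-th graded Betti number dim_K Tor_i(S/I, K)_j in degree j is b: S/I has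
   a graded free resolution, and each of them computes the value b. *)
Definition has_graded_betti (K : fieldType) (n : nat)
    (I : {mpoly K[n]} -> Prop) (i j b : nat) : Prop :=
  (exists F : free_complex K n, graded_free_resolution I F) /\
  (forall F : free_complex K n, graded_free_resolution I F ->
     tor_dim F i j = b).

Section MultiPath.
Variables (m : nat) (l : 'I_m -> nat).

(* The two ends of the paths, and the 2 l_k interior vertices of each path k. *)
Definition mpath_vertex : finType :=
  (bool + {k : 'I_m & 'I_(l k).*2})%type.

Definition mpath_start : mpath_vertex := inl false.
Definition mpath_end : mpath_vertex := inl true.

(* The vertices of path k are [mpath_walk k t] for t = 0, ..., 2 l_k + 1. *)
Definition mpath_walk (k : 'I_m) (t : nat) : mpath_vertex :=
  if t is t'.+1 then
    if insub t' is Some s then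
      inr (Tagged (fun k : 'I_m => 'I_(l k).*2) (s : 'I_(l k).*2))
    else mpath_end
  else mpath_start.

Definition mpath_adj : rel mpath_vertex := fun x y =>
  [exists k : 'I_m, [exists t : 'I_(l k).*2.+1,
    ((x == mpath_walk k t) && (y == mpath_walk k t.+1)) ||
    ((y == mpath_walk k t) && (x == mpath_walk k t.+1))]].

Lemma mpath_adj_sym : ssrbool.symmetric mpath_adj.
Proof.
move=> x y; apply: eq_existsb => k; apply: eq_existsb => t.
by rewrite orbC.
Qed.

Lemma mpath_walk_neq (k : 'I_m) (t : 'I_(l k).*2.+1) :
  mpath_walk k t != mpath_walk k t.+1.
Proof.
case: t => [[|t] lt_t] /=; first by case: insubP.
case: insubP => [s _ vs|]; last by rewrite -ltnS lt_t.
case: insubP => [s' _ vs'|//].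
apply/eqP => -[] /eqP; rewrite -tag_eqE /tag_eq /= eqxx tagged_asE => /eqP ss'.
by move: vs'; rewrite -ss' vs => /eqP; rewrite eqn_leq ltnn andbF.
Qed.

Lemma mpath_adj_irrefl : irreflexive mpath_adj.
Proof.
move=> x; apply/negbTE/negP => /existsP[k /existsP[t]].
by rewrite orbb => /andP[/eqP-> ]; apply/negP; exact: mpath_walk_neq.
Qed.

Definition multipath : sgraph := SGraph mpath_adj_sym mpath_adj_irrefl.

(* Pairs ((k_1, ..., k_(i+1)), r). *)
Definition Oset (i j : nat) : {set i.+1.-tuple 'I_m * 'I_i.+1} :=
  [set x : i.+1.-tuple 'I_m * 'I_i.+1 |
    [&& (\sum_(k <- x.1) l k + x.2 == j)%N,
        sorted (fun a b : 'I_m => (a < b)%N) x.1 & (1 <= x.2)%N]].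

End MultiPath.

(* Main.v *)
(* Let a_k (resp. b_k) be the product of the edges of path k at even (resp. odd) positions. The
   images of a_k and b_k differ by the factor v_1 v_2 for every k, so I_G contains the 2-minors
   of the 2 x m matrix with rows (a_k) and (b_k), whose entries are monomials in disjoint sets
   of variables. If the b_k weigh k and the a_k nothing, the minor of columns i < j has leading
   monomial a_i b_j; monomials divisible by no such product have distinct images, so the minors
   form a Groebner basis of I_G and the square-free monomials a_i b_j generate the initial
   ideal.

   The ideals (a_i b_j - c^(j-i) a_j b_i), for c = 1 and c = 0, are resolved simultaneously by
   a deformation of the Eagon-Northcott complex. It is exact because its terms (monomial times
   basis element) are matched in pairs such that the differential of the upper term of a pair
   has the lower one as leading term. Its generators in homological degree i are pairs (T, p)
   with #|T| = i + 1 and p < i, of degree p + 1 plus the sum of the l_k over T, and it is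
   minimal. Any two graded free resolutions of a homogeneous ideal are homotopy equivalent, so
   all of them compute the same Betti numbers. *)

Require Import Defs.
From HB Require Import structures.
From mathcomp Require Import all_boot all_order all_algebra.
From mathcomp Require Import zify ring.

Set Implicit Arguments.
Unset Strict Implicit.
Unset Printing Implicit Defensive.

Import GRing.Theory.
Local Open Scope ring_scope.

(** * Comparison of graded free resolutions *)

(** A term, a monomial u times a generator (T, p), has a multidegree: u times the product of the
    letters a_s for the p + 1 smallest s in T and b_s for the others. The differential never raises
    the weight of this multidegree, and c appears to the power of the loss. The terms that lose
    nothing are exactly those that keep the multidegree; their coefficients are 1 and -1 whatever c
    is, and they contain every leading term that the matching uses. Hence one exactness proof serves
    both c = 0 and c = 1, and the two ideals get equal Betti numbers from equal generators, with no
    semicontinuity argument. Since a_k has l_k + 1 edges and b_k has l_k, the p + 1 letters a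
    account for the summand r = p + 1 in O_i^j; the bound r <= i says that at least one letter b
    remains. Betti numbers are here a condition on every graded free resolution, minimal or not, so
    a comparison theorem for arbitrary resolutions is needed as well. *)

Section GradedMatrices.
Variables (K : fieldType) (n : nat).
Local Notation S := {mpoly K[n]}.

(** Condition on a matrix entry between generators of degrees r and c: homogeneous of degree r - c,
    and zero when r < c. The additive form avoids truncated subtraction. *)
Definition homogen (r c : nat) (p : S) := forall u, u \in msupp p -> (mdeg u + c)%N = r.

(** The scalar kills the case r < c, where the truncated r - c would select the constant term. *)
Definition hcomp (r c : nat) (p : S) : S := (c <= r)%N%:R *: pihomog mdeg (r - c) p.

Lemma hcomp_is_linear r c : linear (hcomp r c).
Proof.
by move=> a p q; rewrite /hcomp linearP scalerDr !scalerA mulrC.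
Qed.

HB.instance Definition _ r c :=
  GRing.isLinear.Build K S S _ (hcomp r c) (hcomp_is_linear r c).

Lemma hcompX r c u : hcomp r c 'X_[u] = if (mdeg u + c == r)%N then 'X_[u] else 0.
Proof.
rewrite /hcomp pihomogX /=; case: leqP => cr; last first.
  by rewrite scale0r; case: eqP => // e; lia.
rewrite scale1r; congr (if _ then _ else _); apply/eqP/eqP; lia.
Qed.

Lemma hcompE r c p : hcomp r c p = \sum_(u <- msupp p | (mdeg u + c == r)%N) p@_u *: 'X_[u].
Proof.
rewrite {1}(mpolyE p) linear_sum /= [RHS]big_mkcond /=; apply: eq_bigr => u _.
by rewrite linearZ /= hcompX; case: eqP => _ //; rewrite scaler0.
Qed.

Lemma hcomp_homog r c p : homogen r c (hcomp r c p).
Proof.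
move=> u; rewrite hcompE => /msupp_sum_le/flattenP[s /mapP[v]].
rewrite mem_filter => /andP[/eqP <- _] -> /msuppZ_le.
by rewrite msuppX inE => /eqP ->.
Qed.

Lemma hcomp_id r c p : homogen r c p -> hcomp r c p = p.
Proof.
move=> hp; rewrite hcompE [RHS]mpolyE [LHS]big_seq_cond [RHS]big_seq_cond; apply: eq_bigl => u.
by case: (boolP (u \in _)) => //= /hp ->; rewrite eqxx.
Qed.

Lemma hcompM r d c p q : homogen d c q -> hcomp r c (p * q) = hcomp r d p * q.
Proof.
move=> hq; rewrite {1 2}(mpolyE p) linear_sum /= !mulr_suml linear_sum /=.
apply: eq_bigr => u _; rewrite -scalerAl !linearZ /= -scalerAl; congr (_ *: _).
rewrite {1 2}(mpolyE q) !mulr_sumr linear_sum /= [LHS]big_seq [RHS]big_seq;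
  apply: eq_bigr => v /hq hv.
rewrite -!scalerAr linearZ /= -mpolyXD !hcompX mdegD -addnA hv.
by case: eqP => _; rewrite ?mul0r ?mpolyXD.
Qed.

Definition graded_mx (p q : nat) (r : 'I_p -> nat) (c : 'I_q -> nat) (A : 'M[S]_(p, q)) :=
  forall i j, homogen (r i) (c j) (A i j).

Definition hcomp_mx (p q : nat) (r : 'I_p -> nat) (c : 'I_q -> nat) (A : 'M[S]_(p, q)) :=
  \matrix_(i, j) hcomp (r i) (c j) (A i j).

Lemma hcomp_mx_graded p q r c (A : 'M_(p, q)) : graded_mx r c (hcomp_mx r c A).
Proof. by move=> i j; rewrite mxE; exact: hcomp_homog. Qed.

Lemma hcomp_mx_id p q r c (A : 'M_(p, q)) : graded_mx r c A -> hcomp_mx r c A = A.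
Proof. by move=> hA; apply/matrixP => i j; rewrite mxE hcomp_id. Qed.

Lemma hcomp_mxM p q s r d c (A : 'M_(p, q)) (B : 'M_(q, s)) :
  graded_mx d c B -> hcomp_mx r c (A *m B) = hcomp_mx r d A *m B.
Proof.
move=> hB; apply/matrixP => i j; rewrite !mxE linear_sum /=; apply: eq_bigr => k _.
by rewrite mxE (hcompM _ _ (hB k j)).
Qed.

Lemma graded_mxM p q s r d c (A : 'M_(p, q)) (B : 'M_(q, s)) :
  graded_mx r d A -> graded_mx d c B -> graded_mx r c (A *m B).
Proof.
move=> hA hB; rewrite -(hcomp_mx_id hA) -(hcomp_mxM r A hB); exact: hcomp_mx_graded.
Qed.

Lemma graded_mxD p q r c (A B : 'M_(p, q)) :
  graded_mx r c A -> graded_mx r c B -> graded_mx r c (A + B).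
Proof.
move=> hA hB i j u; rewrite mxE => /msuppD_le; rewrite mem_cat => /orP[/hA|/hB] //.
Qed.

Lemma graded_mxN p q r c (A : 'M_(p, q)) : graded_mx r c A -> graded_mx r c (- A).
Proof. by move=> hA i j u; rewrite mxE (perm_mem (msuppN _)) => /hA. Qed.

Lemma graded_mx1 p r : graded_mx r r (1%:M : 'M_p).
Proof.
move=> i j u; rewrite mxE; case: eqP => [->|_]; last by rewrite mulr0n msupp0.
by rewrite mulr1n msupp1 inE => /eqP ->; rewrite mdeg0.
Qed.

Lemma graded_mx_res p q r c (A : 'M_(p, q)) i j :
  graded_mx r c A -> (A i j)@_0%MM != 0 -> r i = c j.
Proof. by move=> hA; rewrite -mcoeff_msupp => /hA; rewrite mdeg0. Qed.

Definition exact_at p q s (D2 : 'M[S]_(p, q)) (D1 : 'M[S]_(q, s)) :=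
  forall w : 'rV_q, w *m D1 = 0 <-> exists w', w = w' *m D2.

Lemma row_factor p q s (A : 'M[S]_(s, q)) (D : 'M[S]_(p, q)) :
  (forall i, exists w, row i A = w *m D) -> exists W, A = W *m D.
Proof.
move=> /fin_all_exists[w hw]; exists (\matrix_i w i); apply/row_matrixP => i.
by rewrite row_mul rowK.
Qed.

Lemma exact_at_mul0 p q s (D2 : 'M[S]_(p, q)) (D1 : 'M[S]_(q, s)) :
  exact_at D2 D1 -> D2 *m D1 = 0.
Proof.
move=> h; apply/row_matrixP => i; rewrite row_mul row0; apply/h.
by exists (delta_mx 0 i); rewrite -rowE.
Qed.

(** Exactness gives a lift without control of degrees. Its component of the right degree is still a
    lift, because taking components commutes with multiplication by a graded matrix. *)
Lemma graded_lift p q s t r2 r1 (r : 'I_t -> nat) (A : 'M[S]_(t, q)) (D2 : 'M[S]_(p, q))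
    (D1 : 'M[S]_(q, s)) :
  exact_at D2 D1 -> graded_mx r2 r1 D2 -> graded_mx r r1 A -> A *m D1 = 0 ->
  exists W, graded_mx r r2 W /\ A = W *m D2.
Proof.
move=> hD gD gA AD0; case: (@row_factor _ _ _ A D2) => [i|W defA].
  by apply/hD; rewrite -row_mul AD0 row0.
exists (hcomp_mx r r2 W); split; first exact: hcomp_mx_graded.
by rewrite -(hcomp_mxM _ _ gD) -defA hcomp_mx_id.
Qed.

End GradedMatrices.

(** By the last hypothesis the kernel of the map from Z to Z' modulo B' induced by f has dimension
    at most the rank of B. *)
Lemma rank_subquotient_le (K : fieldType) (p q a b a' b' : nat) (Z : 'M[K]_(a, p))
    (B : 'M[K]_(b, p)) (Z' : 'M[K]_(a', q)) (B' : 'M[K]_(b', q)) (f : 'M[K]_(p, q)) :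
  (Z *m f <= Z')%MS -> (B' <= Z')%MS ->
  (forall z : 'rV_p, (z <= Z)%MS -> (z *m f <= B')%MS -> (z <= B)%MS) ->
  (\rank Z - \rank B <= \rank Z' - \rank B')%N.
Proof.
move=> Zf B'Z' zB; pose C := f *m cokermx B'.
have h1 := mxrank_mul_ker Z C; have h2 := mxrank_mul_ker Z' (cokermx B').
have h3 : (\rank (Z :&: kermx C) <= \rank B)%N.
  apply/mxrankS/row_subP => i; have := row_sub i (Z :&: kermx C)%MS.
  rewrite sub_capmx => /andP[zZ /sub_kermxP zC]; apply: zB => //.
  by rewrite submxE -mulmxA zC.
have h4 : (\rank (Z *m C) <= \rank (Z' *m cokermx B'))%N.
  by rewrite mulmxA mxrankS ?submxMr.
have h5 : (\rank B' <= \rank (Z' :&: kermx (cokermx B')))%N.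
  by apply: mxrankS; rewrite sub_capmx B'Z'; apply/sub_kermxP; exact: mulmx_coker.
lia.
Qed.

Section Comparison.
Variables (K : fieldType) (n : nat) (I : {mpoly K[n]} -> Prop).
Local Notation S := {mpoly K[n]}.

Definition homog_ideal :=
  [/\ I 0, forall p q, I p -> I q -> I (p + q), forall p q, I q -> I (p * q)
    & forall r c p, I p -> I (hcomp r c p)].
Hypothesis hI : homog_ideal.

Lemma sub_mxE p q (A B : 'M[S]_(p, q)) i j : (A - B) i j = A i j - B i j.
Proof. by rewrite mxE [X in _ + X]mxE. Qed.

Lemma ideal_congr p q : I q -> I (p - q) -> I p.
Proof. by case: hI => _ D M _ Iq /(D _ _ Iq); rewrite addrC subrK. Qed.

Lemma ideal_mulmx p q (A : 'M[S]_(p, q)) (v : 'cV_q) :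
  (forall k, I (v k 0)) -> forall k, I ((A *m v) k 0).
Proof.
case: hI => I0 D M _ Iv k; rewrite mxE.
by elim/big_ind: _ => // j _; exact: M.
Qed.

Section Resolution.
Variable (F : free_complex K n).
Hypothesis hF : graded_free_resolution I F.

Lemma res_graded i : graded_mx (@cx_deg _ _ F i.+1) (@cx_deg _ _ F i) (cx_diff F i).
Proof. by case: hF => -[_ h] _ _ _ k k'; exact: h. Qed.

Lemma res_exact i : exact_at (cx_diff F i.+1) (cx_diff F i).
Proof. by case: hF => _ _ _ h w; exact: h. Qed.

Lemma res_mul0 i : cx_diff F i.+1 *m cx_diff F i = 0.
Proof. exact/exact_at_mul0/res_exact. Qed.

Lemma res_aug_graded : graded_mx (@cx_deg _ _ F 0) (fun=> 0%N) (cx_aug F).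
Proof. by case: hF => -[h _] _ _ _ k k' u; rewrite (ord1 k') addn0; exact: h. Qed.

Lemma res_aug_mul0 k : I ((cx_diff F 0 *m cx_aug F) k 0).
Proof.
case: hF => _ _ h _; have /h : exists w', row k (cx_diff F 0) = w' *m cx_diff F 0.
  by exists (delta_mx 0 k); rewrite -rowE.
by rewrite -row_mul mxE.
Qed.

Lemma res_lift_aug p (r : 'I_p -> nat) (A : 'cV[S]_p) : graded_mx r (fun=> 0%N) A ->
  exists W, graded_mx r (@cx_deg _ _ F 0) W /\ forall k, I ((W *m cx_aug F) k 0 - A k 0).
Proof.
move=> gA; have [_ surj _ _] := hF; case: hI => _ _ _ IH.
have [w hw] := fin_all_exists (fun k => surj (A k 0)).
exists (hcomp_mx r (@cx_deg _ _ F 0) (\matrix_k w k)); split; first exact: hcomp_mx_graded.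
move=> k; rewrite -(hcomp_mxM _ _ res_aug_graded) mxE.
have -> : A k 0 = hcomp (r k) 0 (A k 0) by rewrite hcomp_id //; exact: (gA k 0).
rewrite -raddfB /=; apply: IH.
have -> : ((\matrix_k0 w k0) *m cx_aug F) k 0 = (w k *m cx_aug F) 0 0.
  by rewrite -[w k](rowK w) -row_mul [RHS]mxE.
exact: hw.
Qed.

Lemma res_lift0 p (r : 'I_p -> nat) (A : 'M[S]_(p, cx_rank F 0)) :
  graded_mx r (@cx_deg _ _ F 0) A -> (forall k, I ((A *m cx_aug F) k 0)) ->
  exists W, graded_mx r (@cx_deg _ _ F 1) W /\ A = W *m cx_diff F 0.
Proof.
move=> gA AI; have [_ _ ex _] := hF.
case: (@row_factor _ _ _ _ _ A (cx_diff F 0)) => [i|W defA].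
  by apply/ex; rewrite -row_mul mxE.
exists (hcomp_mx r (@cx_deg _ _ F 1) W); split; first exact: hcomp_mx_graded.
by rewrite -(hcomp_mxM _ _ (@res_graded 0)) -defA hcomp_mx_id.
Qed.

End Resolution.

Section ChainMaps.
Variables (F F' : free_complex K n).
Hypotheses (hF : graded_free_resolution I F) (hF' : graded_free_resolution I F').

Local Notation gr i f := (graded_mx (@cx_deg _ _ F i) (@cx_deg _ _ F' i) f).

Lemma chain_map0 : exists f0 : 'M_(cx_rank F 0, cx_rank F' 0),
  gr 0 f0 /\ forall k, I ((f0 *m cx_aug F' - cx_aug F) k 0).
Proof.
have [f0 [gf0 hf0]] := res_lift_aug hF' (res_aug_graded hF).
by exists f0; split=> // k; rewrite sub_mxE.
Qed.

Lemma chain_map1 (f0 : 'M_(cx_rank F 0, cx_rank F' 0)) :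
  gr 0 f0 -> (forall k, I ((f0 *m cx_aug F' - cx_aug F) k 0)) ->
  exists f1 : 'M_(cx_rank F 1, cx_rank F' 1), gr 1 f1 /\ cx_diff F 0 *m f0 = f1 *m cx_diff F' 0.
Proof.
move=> gf0 hf0; apply: (res_lift0 hF' (graded_mxM (res_graded hF (i:=0)) gf0)) => k.
apply: (@ideal_congr _ ((cx_diff F 0 *m cx_aug F) k 0)); first exact: res_aug_mul0.
by rewrite -sub_mxE -mulmxA -mulmxBr; apply: ideal_mulmx.
Qed.

Lemma chain_mapS i (f0 : 'M_(cx_rank F i, cx_rank F' i))
    (f1 : 'M_(cx_rank F i.+1, cx_rank F' i.+1)) :
  gr i.+1 f1 -> cx_diff F i *m f0 = f1 *m cx_diff F' i ->
  exists f2 : 'M_(cx_rank F i.+2, cx_rank F' i.+2),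
    gr i.+2 f2 /\ cx_diff F i.+1 *m f1 = f2 *m cx_diff F' i.+1.
Proof.
move=> gf1 f01; apply: (graded_lift (res_exact hF' (i:=i)) (res_graded hF' (i:=i.+1))
  (graded_mxM (res_graded hF (i:=i.+1)) gf1)).
by rewrite -mulmxA -f01 mulmxA res_mul0 ?mul0mx.
Qed.
End ChainMaps.

Section Homotopy.
Variables (F F' : free_complex K n).
Hypotheses (hF : graded_free_resolution I F) (hF' : graded_free_resolution I F').

Local Notation d F i := (@cx_deg _ _ F i).

(* The last conjunct is what makes the homotopy extend one step further: [1 - f0 g0] equals [h
   D] up to the image of the homotopy one step below. *)
Definition homotopy_step i (f0 : 'M[S]_(cx_rank F i, cx_rank F' i))
    (f1 : 'M[S]_(cx_rank F i.+1, cx_rank F' i.+1))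
    (g0 : 'M[S]_(cx_rank F' i, cx_rank F i))
    (g1 : 'M[S]_(cx_rank F' i.+1, cx_rank F i.+1))
    (h : 'M[S]_(cx_rank F i, cx_rank F i.+1)) : Prop :=
  [/\ graded_mx (d F i) (d F' i) f0 /\ graded_mx (d F i.+1) (d F' i.+1) f1,
      graded_mx (d F' i) (d F i) g0 /\ graded_mx (d F' i.+1) (d F i.+1) g1,
      graded_mx (d F i) (d F i.+1) h,
      cx_diff F i *m f0 = f1 *m cx_diff F' i /\ cx_diff F' i *m g0 = g1 *m cx_diff F i
    & cx_diff F i *m (1%:M - f0 *m g0 - h *m cx_diff F i) = 0].

Lemma homotopy_step0 : exists f0 f1 g0 g1 h, @homotopy_step 0 f0 f1 g0 g1 h.
Proof.
have [f0 [gf0 hf0]] := chain_map0 hF hF'; have [f1 [gf1 f01]] := chain_map1 hF hF' gf0 hf0.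
have [g0 [gg0 hg0]] := chain_map0 hF' hF; have [g1 [gg1 g01]] := chain_map1 hF' hF gg0 hg0.
have g1fg : graded_mx (d F 0) (d F 0) (1%:M - f0 *m g0).
  apply: graded_mxD; first exact: graded_mx1.
  by apply/graded_mxN/(graded_mxM gf0 gg0).
have [|h [gh hh]] := res_lift0 hF g1fg.
  move=> k; have -> : (1%:M - f0 *m g0) *m cx_aug F =
      - (f0 *m (g0 *m cx_aug F - cx_aug F')) - (f0 *m cx_aug F' - cx_aug F).
    by rewrite mulmxBl mul1mx -mulmxA mulmxBr !opprB [RHS]addrC addrA subrK.
  case: hI => _ D M _; rewrite mxE; apply: D; rewrite mxE -mulN1r; apply: M => //.
  exact: ideal_mulmx.
exists f0, f1, g0, g1, h; split=> //.
by rewrite hh subrr mulmx0.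
Qed.

(** The last conjunct of the previous step says that the differential kills [1 - f1 g1 - D h], so
    exactness writes this defect as [h1 D]. Then [1 - f1 g1 - h1 D] equals [D h], which is killed
    from the left since D D = 0. *)
Lemma homotopy_stepS i f0 f1 g0 g1 h : @homotopy_step i f0 f1 g0 g1 h ->
  exists f2 g2 h1, homotopy_step f1 f2 g1 g2 h1 /\
    1%:M - f1 *m g1 = cx_diff F i *m h + h1 *m cx_diff F i.+1.
Proof.
case=> -[gf0 gf1] [gg0 gg1] gh [f01 g01] hD.
have [f2 [gf2 f12]] := chain_mapS hF hF' gf1 f01.
have [g2 [gg2 g12]] := chain_mapS hF' hF gg1 g01.
have gA : graded_mx (d F i.+1) (d F i.+1) (1%:M - f1 *m g1 - cx_diff F i *m h).
  apply: graded_mxD; last exact/graded_mxN/(graded_mxM (res_graded hF (i:=i)) gh).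
  apply: graded_mxD; first exact: graded_mx1.
  by apply/graded_mxN/(graded_mxM gf1 gg1).
have [|h1 [gh1 hh1]] := graded_lift (res_exact hF (i:=i)) (res_graded hF (i:=i.+1)) gA.
  by rewrite !mulmxBl mul1mx -mulmxA -g01 mulmxA -f01 -hD !mulmxBr mulmx1 !mulmxA.
exists f2, g2, h1; split; last by rewrite -hh1 [RHS]addrC subrK.
split=> //; rewrite -hh1.
by rewrite opprB addrCA subrr addr0 mulmxA (res_mul0 hF) mul0mx.
Qed.

Lemma homotopy_stepP i : exists f0 f1 g0 g1 h, @homotopy_step i f0 f1 g0 g1 h.
Proof.
elim: i => [|i [f0 [f1 [g0 [g1 [h]]]]]]; first exact: homotopy_step0.
by case/homotopy_stepS => f2 [g2 [h1 [H _]]]; exists f1, f2, g1, g2, h1.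
Qed.
End Homotopy.

(** * Tensoring with the residue field *)

Local Notation P := degree_part.
Local Notation rs := (map_mx (mcoeff 0%MM)).

(** A graded matrix has nonzero constant terms only between generators of equal degree. *)
Lemma degree_part_comm (F F' : free_complex K n) i i' j
    (A : 'M[S]_(cx_rank F i, cx_rank F' i')) :
  graded_mx (@cx_deg _ _ F i) (@cx_deg _ _ F' i') A -> P F i j *m rs A = rs A *m P F' i' j.
Proof.
move=> gA; apply/matrixP => k k'; rewrite /degree_part mul_diag_mx mul_mx_diag !mxE.
case: (eqVneq ((A k k')@_0%MM) 0) => [->|/(graded_mx_res gA) ->]; first by rewrite mulr0 mul0r.
by rewrite mulrC.
Qed.

Lemma degree_part_idem (F : free_complex K n) i j : P F i j *m P F i j = P F i j.
Proof.
apply/matrixP => k k'; rewrite /degree_part mul_diag_mx !mxE.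
by case: (_ == j); rewrite ?mul1r // !mul0r // mul0rn.
Qed.

Lemma sub_degree_part (F : free_complex K n) i j p (z : 'M_(p, _)) :
  (z <= P F i j)%MS -> z *m P F i j = z.
Proof. by case/submxP => y ->; rewrite -mulmxA degree_part_idem. Qed.

Lemma boundaries_sub_cycles (F : free_complex K n) i j : graded_free_resolution I F ->
  (boundaries F i.+1 j <= cycles F i.+1 j)%MS.
Proof.
move=> hF; rewrite /boundaries /residue_diff /= sub_capmx.
rewrite (degree_part_comm _ (res_graded hF (i:=i.+1))) submxMl.
rewrite -(degree_part_comm _ (res_graded hF (i:=i.+1))); apply/sub_kermxP.
by rewrite -mulmxA -map_mxM (res_mul0 hF) map_mx0 mulmx0.
Qed.

(** The reduction of [f1] is injective on homology: a cycle z satisfies z = z f1 g1 + z h1 D, so it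
    is a boundary as soon as z f1 is one. One homotopy therefore gives one inequality, and symmetry
    gives the other. *)
Lemma tor_dim_le (F F' : free_complex K n) i j :
  graded_free_resolution I F -> graded_free_resolution I F' ->
  (tor_dim F i.+1 j <= tor_dim F' i.+1 j)%N.
Proof.
move=> hF hF'.
have [f0 [f1 [g0 [g1 [h H0]]]]] := homotopy_stepP hF hF' i.
have [f2 [g2 [h1 [H1 hfg]]]] := homotopy_stepS hF hF' H0.
case: H0 => -[gf0 gf1] [gg0 gg1] gh [f01 g01] _.
case: H1 => -[_ gf2] [_ gg2] gh1 [f12 g12] _.
apply: (@rank_subquotient_le _ _ _ _ _ _ _ _ _ _ _ (rs f1)).
- rewrite /= sub_capmx; apply/andP; split.
    apply: submx_trans (submxMr _ (capmxSl _ _)) _.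
    by rewrite (degree_part_comm _ gf1) submxMl.
  apply/sub_kermxP; rewrite -mulmxA -map_mxM -f01 map_mxM mulmxA.
  by have /sub_kermxP -> := capmxSr (P F i.+1 j) (kermx (residue_diff F i)); rewrite mul0mx.
- exact: boundaries_sub_cycles.
move=> z; rewrite /= sub_capmx => /andP[/sub_degree_part zP /sub_kermxP zD] /submxP[y zf].
have -> : z = z *m rs f1 *m rs g1 + z *m rs h1 *m residue_diff F i.+1.
  rewrite -!mulmxA -!map_mxM -[LHS]mulmx1 -(map_mx1 (mcoeff 0%MM : {rmorphism S -> K})).
  rewrite -[1%:M](subrK (f1 *m g1)) hfg !map_mxD !mulmxDr !map_mxM mulmxA zD mul0mx add0r.
  by rewrite addrC.
apply: addmx_sub.
  rewrite zf /boundaries -!mulmxA -!map_mxM g12 !map_mxM.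
  by rewrite [P F' _ _ *m _]mulmxA (degree_part_comm _ gg2) -!mulmxA mulmxA submxMl.
rewrite -zP -!mulmxA [P F _ _ *m _]mulmxA (degree_part_comm _ gh1) -!mulmxA mulmxA.
exact: submxMl.
Qed.

Lemma tor_dim_unique (F F' : free_complex K n) i j :
  graded_free_resolution I F -> graded_free_resolution I F' ->
  tor_dim F i.+1 j = tor_dim F' i.+1 j.
Proof. by move=> hF hF'; apply/eqP; rewrite eqn_leq !tor_dim_le. Qed.

End Comparison.

(** * Exactness from a matching of terms *)

Section Matching.
Variables (K : fieldType) (n : nat).
Local Notation S := {mpoly K[n]}.

Lemma mcoeffXM (p : S) u v : ('X_[u] * p)@_(u + v)%MM = p@_v.
Proof. by rewrite -commr_mpolyX mcoeffMX. Qed.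

Lemma msuppXM_ex (p : S) u x : x \in msupp ('X_[u] * p) ->
  exists2 v, v \in msupp p & x = (u + v)%MM.
Proof.
case/msuppM_le/allpairsP => -[a v] /= [] /[!msuppX] /[!inE] /eqP -> vp ->.
by exists v.
Qed.

Definition term r (c : K) (u : 'X_{1..n}) (k : 'I_r) : 'rV[S]_r :=
  (c *: 'X_[u]) *: delta_mx 0 k.

Lemma termE r c u (k : 'I_r) k' :
  term c u k 0 k' = if k' == k then c *: 'X_[u] else 0.
Proof. by rewrite /term !mxE eqxx; case: eqP; rewrite ?mulr1 ?mulr0. Qed.

Lemma mulmx_termE r s c u (k : 'I_r) (D : 'M[S]_(r, s)) k' :
  (term c u k *m D) 0 k' = c *: ('X_[u] * D k k').
Proof. by rewrite /term -scalemxAl mxE -rowE mxE scalerAl. Qed.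

Lemma rowvec_terms r (w : 'rV[S]_r) :
  w = \sum_k \sum_(u <- msupp (w 0 k)) term (w 0 k)@_u u k.
Proof.
apply/rowP => k; rewrite summxE (bigD1 k) //= [X in _ + X]big1 ?addr0 => [|k' nk].
  by rewrite summxE [LHS]mpolyE; apply: eq_bigr => u _; rewrite termE eqxx.
rewrite summxE big1 // => u _; rewrite termE.
by rewrite eq_sym (negPf nk).
Qed.

(** The image of the term u e_k has (u + v) e_k0 as its unique term of greatest rank. The rank may
    depend on u, so it is evaluated after multiplication. *)
Definition leads r s (rho : 'X_{1..n} -> 'I_s -> nat) (D : 'M[S]_(r, s))
    (u : 'X_{1..n}) k (v : 'X_{1..n}) k0 :=
  v \in msupp (D k k0) /\ forall v' k', v' \in msupp (D k k') ->
    (v', k') = (v, k0) \/ (rho (u + v')%MM k' < rho (u + v)%MM k0)%N.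

Variables (r2 r1 r0 : nat) (D2 : 'M[S]_(r2, r1)) (D1 : 'M[S]_(r1, r0)).
Variables (rho1 : 'X_{1..n} -> 'I_r1 -> nat) (rho0 : 'X_{1..n} -> 'I_r0 -> nat).
(** [U] marks the terms that are matched with a term one homological degree higher; all others are
    matched downwards. [R] relates such a term to its match and may record more than the leading
    term, which is what makes the match recover its source. *)
Variables (U : 'X_{1..n} -> 'I_r1 -> bool).
Variable R : 'X_{1..n} -> 'I_r1 -> 'X_{1..n} -> 'I_r0 -> Prop.
Hypothesis D21 : D2 *m D1 = 0.
Hypothesis hU : forall u k, U u k ->
  exists u' k' v, leads rho1 D2 u' k' v k /\ u = (u' + v)%MM.
Hypothesis hD : forall u k, ~~ U u k ->
  exists v k0, leads rho0 D1 u k v k0 /\ R u k (u + v)%MM k0.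
Hypothesis R_inj : forall u k u' k' t k0, ~~ U u k -> ~~ U u' k' ->
  R u k t k0 -> R u' k' t k0 -> (u, k) = (u', k').

Let reducible (w : 'rV[S]_r1) := exists w' : 'rV[S]_r2, forall k u,
  u \in msupp ((w - w' *m D2) 0 k) -> ~~ U u k.

Let reducibleD w1 w2 : reducible w1 -> reducible w2 -> reducible (w1 + w2).
Proof.
case=> [a ha] [b hb]; exists (a + b) => k u.
have -> : w1 + w2 - (a + b) *m D2 = (w1 - a *m D2) + (w2 - b *m D2).
  by rewrite mulmxDl opprD addrACA.
by rewrite mxE => /msuppD_le; rewrite mem_cat => /orP[/ha|/hb].
Qed.

Let reducible0 : reducible 0.
Proof. by exists 0 => k u; rewrite mul0mx subr0 mxE msupp0. Qed.

Let reducible_terms (w : 'rV[S]_r1) : (forall k u, u \in msupp (w 0 k) -> reducible (term (w 0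
  k)@_u u k)) ->
  reducible w.
Proof.
move=> h; rewrite (rowvec_terms w); elim/big_ind: _ => // k _.
by rewrite big_seq; elim/big_ind: _ => // u /h.
Qed.

(** Division with remainder: subtracting a multiple of the image of the upper partner cancels a
    marked term and leaves only terms of smaller rank. *)
Let reducible_term c u k : reducible (term c u k).
Proof.
have [N] := ubnP (rho1 u k); elim: N => // N IH in c u k *; rewrite ltnS => leN.
have [/hU[u' [k' [v [[vD lt_v] defu]]]]|nU] := boolP (U u k); last first.
  exists 0 => k1 u1; rewrite mul0mx subr0 termE.
  case: eqP => [->|_]; last by rewrite msupp0.
  by move/msuppZ_le; rewrite msuppX inE => /eqP ->.
pose c0 := (D2 k' k)@_v; have c0n0 : c0 != 0 by rewrite -mcoeff_msupp.
pose w' := term (c / c0) u' k'; pose E := term c u k - w' *m D2.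
suff [w'' hw''] : reducible E.
  by exists (w'' + w') => k1 u1; rewrite mulmxDl opprD addrA addrAC => /hw''.
apply: reducible_terms => k1 x xE; apply: IH; apply: leq_trans leN.
have coefE : (E 0 k1)@_x = (if k1 == k then c else 0) * (u == x)%:R
    - c / c0 * ('X_[u'] * D2 k' k1)@_x.
  rewrite sub_mxE termE mulmx_termE mcoeffB mcoeffZ; congr (_ - _).
  by case: eqP => _; rewrite ?mcoeffZ ?mcoeffX ?mcoeff0 ?mul0r.
have [[ek eu]|neq] := eqVneq (k1, x) (k, u).
  move: xE; rewrite mcoeff_msupp coefE ek eu !eqxx mulr1 defu mcoeffXM divfK //.
  by rewrite subrr eqxx.
have : x \in msupp ('X_[u'] * D2 k' k1).
  move: xE; rewrite !mcoeff_msupp coefE; apply: contra => /eqP ->.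
  rewrite mulr0 subr0; move: neq; rewrite xpair_eqE negb_and.
  by case: eqP => //= _; rewrite ?mul0r // eq_sym => /negPf ->; rewrite mulr0.
case/msuppXM_ex => v' v'D xe; case: (lt_v _ _ v'D) => [[ev ek]|]; last by rewrite -xe -defu.
by move: neq; rewrite xe ev ek defu eqxx.
Qed.

Let reducibleT w : reducible w.
Proof. by apply: reducible_terms => k u _; exact: reducible_term. Qed.

(** The image of a term can cancel only against another term of w. The latter either has the same
    leading image, excluded by [R_inj], or has a leading image of greater rank. Ranks of leading
    images are bounded by [B], so this ascent stops. *)
Let down_inj (w : 'rV[S]_r1) : w *m D1 = 0 -> (forall k u, u \in msupp (w 0 k) -> ~~ U u k) -> w
  = 0.
Proof.
move=> wD hw; suff h : forall k u, u \notin msupp (w 0 k).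
  apply/rowP => k; rewrite mxE; apply/mpolyP => u; rewrite mcoeff0.
  by apply/eqP; rewrite mcoeff_eq0.
pose B := (\max_(k < r1) \max_(u <- msupp (w 0%R k)) \max_(k0 < r0)
    \max_(v <- msupp (D1 k k0)) rho0 (u + v)%MM k0)%N.
have leB u k v k0 : u \in msupp (w 0 k) -> leads rho0 D1 u k v k0 ->
    (rho0 (u + v)%MM k0 <= B)%N.
  move=> uw [vD _].
  apply: leq_trans (leq_bigmax k); apply: leq_trans (leq_bigmax_seq _ uw isT).
  by apply: leq_trans (leq_bigmax k0); apply: (leq_bigmax_seq (F := fun v => rho0 (u + v)%MM k0)).
suff main g u k v k0 : u \in msupp (w 0 k) -> leads rho0 D1 u k v k0 ->
    R u k (u + v)%MM k0 -> (B - rho0 (u + v)%MM k0 < g)%N -> False.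
  move=> k u; apply/negP => uw; have [v [k0 [lv Rv]]] := hD (hw _ _ uw).
  exact: main uw lv Rv (ltnSn _).
elim: g => // g IH in u k v k0 *; move=> uw lv Rv; rewrite ltnS => leg.
have /rowP/(_ k0) := wD; rewrite [w]rowvec_terms mulmx_suml summxE !mxE.
under eq_bigr => k1 _.
  rewrite mulmx_suml summxE; under eq_bigr => u1 _ do rewrite mulmx_termE.
  over.
move/(congr1 (mcoeff (u + v)%MM)); rewrite mcoeff0 raddf_sum /=.
under eq_bigr => k1 _ do rewrite raddf_sum /=.
have key k1 u1 : u1 \in msupp (w 0 k1) -> (u1, k1) != (u, k) ->
    ((w 0 k1)@_u1 *: ('X_[u1] * D1 k1 k0))@_(u + v)%MM = 0.
  move=> u1w neq; rewrite mcoeffZ; suff: (u + v)%MM \notin msupp ('X_[u1] * D1 k1 k0).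
    by rewrite -mcoeff_eq0 => /eqP ->; rewrite mulr0.
  apply/negP => /msuppXM_ex[v1 v1D e1].
  have [v2 [k2 [lv2 Rv2]]] := hD (hw _ _ u1w); have [_ h2] := lv2.
  case: (h2 _ _ v1D) => [[ev ek]|].
    rewrite -ev -ek -e1 in Rv2; case: (R_inj (hw _ _ u1w) (hw _ _ uw) Rv2 Rv) => eu ekk.
    by move: neq; rewrite eu ekk eqxx.
  rewrite -e1 => lt; have lB := leB _ _ _ _ u1w lv2.
  apply: (IH _ _ _ _ u1w lv2 Rv2); have := leB _ _ _ _ uw lv; lia.
rewrite (bigD1 k) //= [X in _ + X]big1 ?addr0 => [|k1 nk]; last first.
  rewrite big_seq big1 // => u1 u1w; apply: key => //.
  by rewrite xpair_eqE (negPf nk) andbF.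
rewrite (bigD1_seq u) ?msupp_uniq //= [X in _ + X]big_seq_cond [X in _ + X]big1 ?addr0; last first.
  by move=> u1 /andP[u1w nu]; apply: key => //; rewrite xpair_eqE (negPf nu).
rewrite mcoeffZ mcoeffXM => /eqP; rewrite mulf_eq0 !mcoeff_eq0 uw /=.
by case: lv => ->.
Qed.

Lemma matching_exact : exact_at D2 D1.
Proof.
move=> w; split=> [wD|[w' ->]]; last by rewrite -mulmxA D21 mulmx0.
have [w' hw'] := reducibleT w; exists w'; apply/eqP; rewrite -subr_eq0; apply/eqP.
by apply: down_inj hw'; rewrite mulmxBl wD -mulmxA D21 mulmx0 subr0.
Qed.

End Matching.

(** * Weights of cells *)

Section CellWeights.
Variable m : nat.
Implicit Types (T : {set 'I_m}) (s t : 'I_m) (d : bool).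
Local Open Scope nat_scope.

Definition nge T (v : nat) := #|[set t in T | v <= t]|.
(** The number of letters b in the monomial under (T, p). *)
Definition quota T p := #|T| - p.+1.
(* The sum of the [quota T p] largest elements of [T], computed layer by layer: the largest
   elements contribute to layer [v] as long as they exceed [v]. *)
Definition cell_weight T p := \sum_(v < m) minn (nge T v.+1) (quota T p).
Definition above T s := nge T s.+1.

Lemma sum_ltn_ord k : k <= m -> \sum_(v < m) (v < k) = k.
Proof.
elim: m => [|m' IH]; first by rewrite big_ord0; case: k.
rewrite big_ord_recr /=; case: (ltngtP k m'.+1) => // [lt _|-> _].
  have k_le : k <= m' by []. by rewrite (IH k_le) addn0.
under eq_bigr => i _ do rewrite (ltn_trans (ltn_ord i) (ltnSn _)).
by rewrite sum_nat_const card_ord muln1 addn1.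
Qed.

Lemma ngeD1 T s v : s \in T -> nge T v = nge (T :\ s) v + (v <= s).
Proof.
move=> sT; rewrite /nge (cardsD1 s) inE sT /= addnC; congr (#|pred_of_set _| + _).
by apply/setP => t; rewrite !inE andbA.
Qed.

Lemma nge_le T v w : v <= w -> nge T w <= nge T v.
Proof.
move=> vw; apply/subset_leq_card/subsetP => t; rewrite !inE => /andP[-> /=].
exact: leq_trans.
Qed.

Lemma nge0 T : nge T 0 = #|T|.
Proof. by apply: eq_card => t; rewrite !inE andbT. Qed.

Lemma nge_mem T s v : s \in T -> v <= s -> 0 < nge T v.
Proof. by move=> sT vs; rewrite (ngeD1 _ sT) vs addn1. Qed.

Lemma nge_above T s : s \in T -> nge T s = (above T s).+1.
Proof.
move=> sT; rewrite /above (ngeD1 _ sT) (ngeD1 s.+1 sT) leqnn ltnn addn0 addn1.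
congr _.+1; apply: eq_card => t; rewrite !inE ltn_neqAle; case: eqVneq => //= ts.
by rewrite eq_sym (_ : (t == s :> nat) = (t == s)) // (negPf ts).
Qed.

Lemma above_lt T s : s \in T -> above T s < #|T|.
Proof. by move=> sT; rewrite -nge_above // -nge0 nge_le. Qed.

Section Drop.
Variables (T : {set 'I_m}) (s : 'I_m) (d : bool) (p p' N : nat).
Hypotheses (sT : s \in T) (defp : p = p' + d) (cardT : #|T| = N.+1) (ltp : p < N).

Let quotaT : quota T p = N - p.
Proof. by rewrite /quota cardT. Qed.

Let quotaD : quota (T :\ s) p' = N - p'.+1.
Proof. by rewrite /quota; have := cardsD1 s T; rewrite cardT sT add1n => -[->]. Qed.

Let drop_term (v : 'I_m) : minn (nge (T :\ s) v.+1) (quota (T :\ s) p') + (~~ d) * (v < s)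
  <= minn (nge T v.+1) (quota T p).
Proof.
rewrite quotaT quotaD (ngeD1 _ sT); move: (nge _ _) ltp defp => k.
by case: (d) => /=; case: (ltnP v s) => /=; lia.
Qed.

Let sum_terms : \sum_(v < m) (minn (nge (T :\ s) v.+1) (quota (T :\ s) p') + (~~ d) * (v < s))
  = cell_weight (T :\ s) p' + (~~ d) * s.
Proof. by rewrite big_split /= -big_distrr /= sum_ltn_ord // ltnW. Qed.

(** The largest elements of T :\ s that count towards its weight, together with s when s is removed
    with the letter b, are one choice of [quota T p] elements of T; [cell_weight T p] is the maximum
    over all choices. *)
Lemma cell_weight_drop : cell_weight (T :\ s) p' + (~~ d) * s <= cell_weight T p.
Proof. by rewrite -sum_terms; apply: leq_sum. Qed.

(** No weight is lost exactly when s is removed with the letter it carries under (T, p): b if s is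
    among the [quota T p] largest elements, a otherwise. *)
Lemma cell_weight_dropE :
  (cell_weight (T :\ s) p' + (~~ d) * s == cell_weight T p) = (d == (quota T p <= above T s)).
Proof.
rewrite -sum_terms; apply/idP/idP => [|/eqP dE].
  apply: contraTT => nd.
  (* One strict layer is enough: the layer just below s if the letter is a, and s itself if it is
     b. *)
  suff [v lt] : exists v : 'I_m,
      minn (nge (T :\ s) v.+1) (quota (T :\ s) p') + (~~ d) * (v < s)
      < minn (nge T v.+1) (quota T p).
    rewrite neq_ltn; apply/orP; left; rewrite /cell_weight (bigD1 v) //= [ltnRHS](bigD1 v) //=.
    by rewrite -addSn leq_add //; apply: leq_sum.
  have aT := above_lt sT; have aS := nge_above sT.
  have := ngeD1 s.+1 sT; rewrite -/(above T s) ltnn addn0 => eab.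
  have eS := ngeD1 s sT; rewrite leqnn in eS.
  move: nd; rewrite quotaT quotaD; rewrite cardT in aT; case: (d) defp => defp'.
    (* If s were 0, the N other elements of T would all lie above it, which is at least the
       quota. *)
    rewrite eq_sym eqb_id -ltnNge => lt; have s0 : 0 < s.
      rewrite lt0n; apply/eqP => s0; move: aS; rewrite s0 nge0 cardT => -[eN].
      by move: lt; rewrite -eN ltnNge leq_subr.
    exists (Ordinal (leq_ltn_trans (leq_pred s) (ltn_ord s))) => /=.
    rewrite prednK //; move: (nge _ _) (nge _ _) (above T s) aS eS lt => a b k; lia.
  rewrite eq_sym eqbF_neg negbK => le; exists s.
  rewrite -eab -/(above T s) ltnn; move: (above T s) le => a; lia.
apply/eqP/eq_bigr => v _; move: dE; rewrite quotaT quotaD (ngeD1 _ sT).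
have [vs|sv] := ltnP v s.
  have := nge_le T vs; rewrite nge_above // (ngeD1 v.+1 sT) vs.
  move: (nge _ _) (above _ _) ltp defp => a b; case: (d) => /=; lia.
have : nge T v.+1 <= above T s by exact: nge_le.
rewrite (ngeD1 _ sT) ltnNge sv /=.
move: (nge _ _) (above _ _) ltp defp => a b; case: (d) => /=; lia.
Qed.

(** Removing s with its own letter leaves the letters of all other elements unchanged, so the
    multidegree is preserved. *)
Lemma above_drop t : d = (quota T p <= above T s) -> t \in T :\ s ->
  (quota (T :\ s) p' <= above (T :\ s) t) = (quota T p <= above T t).
Proof.
rewrite quotaT quotaD !inE => dE /andP[ts tT].
have := ngeD1 t.+1 sT; rewrite -/(above T t) -/(above (T :\ s) t).
have [lts|sut|/val_inj e] := ltngtP t s; last by rewrite e eqxx in ts.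
  have : (above T s).+1 <= above T t by rewrite -nge_above // nge_le.
  move: (above _ _) (above _ _) (above _ _) dE ltp defp => a b k; case: (d) => /=; lia.
have : (above T t).+1 <= above T s by rewrite -nge_above // nge_le.
move: (above _ _) (above _ _) (above _ _) dE ltp defp => a b k; case: (d) => /=; lia.
Qed.
End Drop.

Lemma mem_le_cell_weight T p s : s \in T -> p.+2 <= #|T| -> s <= cell_weight T p.
Proof.
move=> sT lt; rewrite -{1}(@sum_ltn_ord s) ?(ltnW (ltn_ord s)) //.
apply: leq_sum => v _; case: (ltnP v s) => // vs.
have := nge_mem sT vs; rewrite /quota; lia.
Qed.

Lemma cell_weight_pair T s : #|T| = 2 -> s \in T -> (forall t, t \in T -> t <= s) ->
  cell_weight T 0 = s.
Proof.
move=> T2 sT max; rewrite -[RHS](@sum_ltn_ord s) ?(ltnW (ltn_ord s)) //.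
apply: eq_bigr => v _; rewrite /quota T2; case: ltnP => vs.
  by have := nge_mem sT vs; lia.
suff -> : nge T v.+1 = 0 by [].
apply/eqP; rewrite cards_eq0; apply/eqP/setP => t; rewrite !inE; apply/negP => /andP[/max].
by move=> ts; rewrite ltnNge (leq_trans ts vs).
Qed.

End CellWeights.

(** * The cell complex *)

(** Weight losses of two consecutive steps add up, so the powers of c multiply correctly; the
    truncated differences are exact because no step raises the weight. *)
Lemma subn_chain a b e x y : (b + x <= a)%N -> (e + y <= b)%N ->
  (a - b - x + (b - e - y) = a - e - (x + y))%N.
Proof. lia. Qed.

Section Signs.
Variables (m : nat) (R : comNzRingType).
Implicit Types (T : {set 'I_m}) (s t r : 'I_m).

Definition pos_sign T s : R := (-1) ^+ #|[set t in T | (t < s)%N]|.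

Lemma pos_signC T s t : s \in T -> t \in T -> s != t ->
  pos_sign T t * pos_sign (T :\ t) s = - (pos_sign T s * pos_sign (T :\ s) t).
Proof.
have key a b : a \in T -> b \in T -> #|[set x in T | (x < b)%N]| =
    (#|[set x in T :\ a | (x < b)%N]| + (a < b))%N.
  move=> aT bT; rewrite (cardsD1 a) !inE aT /= addnC; congr (#|pred_of_set _| + _)%N.
  by apply/setP => x; rewrite !inE andbA.
move=> sT tT st; rewrite /pos_sign (key s t) // (key t s) // !exprD.
have [lt|gt|/val_inj e] := ltngtP s t; last by rewrite e eqxx in st.
  by rewrite expr1 expr0; ring.
by rewrite expr1 expr0; ring.
Qed.

Lemma pos_sign_pair T s t : s != t -> T = [set s; t] -> pos_sign T s = - pos_sign T t.
Proof.
move=> st ->; rewrite /pos_sign.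
have key (a b : 'I_m) : a != b -> #|[set x in [set a; b] | (x < a)%N]| = (b < a)%N.
  move=> ab; rewrite (cardsD1 b) !inE eqxx orbT /= -[RHS]addn0; congr (_ + _)%N.
  apply/eqP; rewrite cards_eq0; apply/eqP/setP => x; rewrite !inE.
  by case: (eqVneq x b) => //=; case: (eqVneq x a) => //= ->; rewrite ltnn.
rewrite (key s t) // setUC (key t s) 1?eq_sym //.
by have [lt|gt|/val_inj e] := ltngtP s t; [| |rewrite e eqxx in st]; rewrite ?opprK.
Qed.

(** Here s stays the second index removed, while the first one is exchanged with the one left over.
    Minors need this, because there the remaining index carries a letter too. *)
Lemma pos_signC3 T r s t : T = [set r; s; t] -> r != s -> r != t -> s != t ->
  pos_sign T t * pos_sign (T :\ t) s = - (pos_sign T r * pos_sign (T :\ r) s).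
Proof.
move=> defT rs rt st; have [rT sT tT] : [/\ r \in T, s \in T & t \in T].
  by rewrite defT !inE !eqxx !orbT.
rewrite (pos_signC sT tT st) (pos_signC sT rT) 1?eq_sym // opprK.
have -> : pos_sign (T :\ s) r = - pos_sign (T :\ s) t.
  apply: pos_sign_pair => //; rewrite defT; apply/setP => x; rewrite !inE.
  case: (eqVneq x s) => [->|] /=; last by case: (x == r).
  by rewrite (negPf st) eq_sym (negPf rs).
by rewrite mulrN.
Qed.

(** Pairing s < t with t < s, instead of comparing the sum with its opposite, covers characteristic
    2. *)
Lemma antisym_sum (V : zmodType) T (G : 'I_m -> 'I_m -> V) :
  (forall s t, s \in T -> t \in T -> s != t -> G s t = - G t s) ->
  \sum_(s in T) \sum_(t in T :\ s) G s t = 0.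
Proof.
move=> anti.
have split s : \sum_(t in T :\ s) G s t =
   \sum_(t in T | (s < t)%N) G s t + \sum_(t in T | (t < s)%N) G s t.
  rewrite (bigID (fun t => s < t)%N) /=; congr (_ + _); apply: eq_bigl => t; rewrite !inE.
    by case: eqVneq => [->|]; rewrite ?ltnn ?andbF.
  case: eqVneq => [->|ts]; first by rewrite ltnn andbF.
  by rewrite -leqNgt [(t < s)%N]ltn_neqAle -[(t : nat) == s]/(t == s) ts.
under eq_bigr => s sT do rewrite split.
rewrite big_split /= [X in _ + X](exchange_big_dep (mem T)) /=; last by move=> s t _ /andP[].
rewrite -big_split /= big1 // => s sT.
rewrite [X in _ + X](eq_bigl (fun t => (t \in T) && (s < t)%N)); last first.
  by move=> t; rewrite sT.
rewrite -big_split big1 //= => t /andP[tT lt]; rewrite anti ?addNr //.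
by apply: contraTneq lt => ->; rewrite ltnn.
Qed.
End Signs.

(* Throughout, [mon true s] and [mon false s] are the entries a_s and b_s of the 2 x m matrix. *)
Section Differentials.
Variables (K : fieldType) (n m : nat) (mon : bool -> 'I_m -> 'X_{1..n}) (c : K).
Local Notation S := {mpoly K[n]}.
Implicit Types (T : {set 'I_m}) (s t r : 'I_m) (d e : bool) (p : nat).

(* [cell i] indexes the basis of F_(i+1), not of F_i: (T, p) stands for the Eagon-Northcott
   generator e_T x^(p) y^(i-p). *)
Definition cell i := {x : {set 'I_m} * 'I_i.+1 | #|x.1| == i.+2}.
Definition cell_set i (x : cell i) : {set 'I_m} := (val x).1.
Definition cell_pos i (x : cell i) : nat := (val x).2.

Lemma card_cell i (x : cell i) : #|cell_set x| = i.+2.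
Proof. exact/eqP/(valP x). Qed.

Lemma cell_pos_le i (x : cell i) : (cell_pos x <= i)%N.
Proof. by rewrite /cell_pos -ltnS; case: (val x).2. Qed.

Lemma cell_inj i (x y : cell i) : cell_set x = cell_set y -> cell_pos x = cell_pos y -> x = y.
Proof.
move=> eS ep; apply: val_inj; move: eS ep; rewrite /cell_set /cell_pos.
by case: (val x) (val y) => [a b] [a' b'] /= -> /val_inj ->.
Qed.

Lemma cell_ex i T p : #|T| = i.+2 -> (p <= i)%N ->
  exists x : cell i, cell_set x = T /\ cell_pos x = p.
Proof.
move=> cT pi; have pi' : (p < i.+1)%N by [].
have h : #|(T, Ordinal pi').1| == i.+2 by rewrite /= cT.
by exists (Sub (T, Ordinal pi') h : cell i); rewrite /cell_set /cell_pos SubK.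
Qed.

(* For c = 1 this is the Eagon-Northcott differential; the power of c records by how much a
   term drops the weight, so that c = 0 keeps exactly the weight-preserving terms (0 ^ 0 = 1). *)
Definition diff_entry T p T' p' : S := \sum_(s in T) \sum_(d : bool)
  if (T :\ s == T') && (p == p' + d)%N then
    (pos_sign K T s * c ^+ (cell_weight T p - cell_weight T' p' - ~~ d * s)) *: 'X_[mon d s]
  else 0.

(** For a two-element T this is the deformed 2-minor of the columns in T. *)
Definition minor_entry T : S := \sum_(s in T) \sum_(t in T :\ s)
  (pos_sign K T s * c ^+ (cell_weight T 0 - t)) *: 'X_[mon true s + mon false t].

Lemma sum_entry i (x : cell i.+1) (F : {set 'I_m} -> nat -> S) :
  \sum_(y : cell i) diff_entry (cell_set x) (cell_pos x) (cell_set y) (cell_pos y)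
     * F (cell_set y) (cell_pos y) =
  \sum_(s in cell_set x) \sum_(d : bool)
    if (d <= cell_pos x)%N && (cell_pos x - d <= i)%N then
      (pos_sign K (cell_set x) s * c ^+ (cell_weight (cell_set x) (cell_pos x)
         - cell_weight (cell_set x :\ s) (cell_pos x - d) - ~~ d * s)) *: 'X_[mon d s]
      * F (cell_set x :\ s) (cell_pos x - d)%N
    else 0.
Proof.
set T := cell_set x; set p := cell_pos x.
under eq_bigr => y _ do rewrite /diff_entry mulr_suml.
rewrite exchange_big /=; apply: eq_bigr => s sT.
under eq_bigr => y _ do rewrite mulr_suml.
rewrite exchange_big /=; apply: eq_bigr => d _.
case: ifP => [/andP[dp pd]|no]; last first.
  rewrite big1 // => y _; case: ifP => [/andP[_ /eqP pE]|_]; last by rewrite mul0r.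
  by move: no; rewrite pE leq_addl addnK /= cell_pos_le.
have [|y0 [y0S y0p]] := @cell_ex i (T :\ s) (p - d) _ pd.
  by apply/eqP; rewrite -eqSS -(card_cell x) [in X in _ == X](cardsD1 s) sT.
rewrite (bigD1 y0) //= [X in _ + X]big1 ?addr0 => [|y ny].
  by rewrite y0S y0p eqxx subnK // eqxx.
case: ifP => [/andP[/eqP yS /eqP yp]|_]; last by rewrite mul0r.
by case/eqP: ny; apply: cell_inj; rewrite ?y0S -?yS // y0p yp addnK.
Qed.

(** Removing s with letter d and t with letter e, in either order, gives the same monomial and the
    same total weight loss, but opposite signs. *)
Lemma entry_mul0 i (x : cell i.+2) (z : cell i) : \sum_(y : cell i.+1)
  diff_entry (cell_set x) (cell_pos x) (cell_set y) (cell_pos y)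
  * diff_entry (cell_set y) (cell_pos y) (cell_set z) (cell_pos z) = 0.
Proof.
rewrite (sum_entry x (fun T p => diff_entry T p (cell_set z) (cell_pos z))).
set T := cell_set x; set p := cell_pos x; set T' := cell_set z; set p' := cell_pos z.
have p'i : (p' <= i)%N := cell_pos_le z.
have pi : (p <= i.+2)%N := cell_pos_le x.
pose E s d t e : S :=
  if (T :\ s :\ t == T') && (p == p' + d + e)%N then
    (pos_sign K T s * pos_sign K (T :\ s) t
      * c ^+ (cell_weight T p - cell_weight T' p' - (~~ d * s + ~~ e * t)))
    *: 'X_[mon d s + mon e t]
  else 0.
transitivity (\sum_(s in T) \sum_(t in T :\ s) \sum_(d : bool) \sum_(e : bool) E s d t e).
  apply: eq_bigr => s sT; rewrite [RHS]exchange_big /=; apply: eq_bigr => d _.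
  have cD : #|T :\ s| = i.+3 by apply/eqP;
    rewrite -eqSS -(card_cell x) [in X in _ == X](cardsD1 s) sT.
  case: ifP => [/andP[dp pd]|no].
    rewrite /diff_entry mulr_sumr; apply: eq_bigr => t tT; rewrite mulr_sumr; apply: eq_bigr => e _.
    rewrite /E; have -> : (p - d == p' + e)%N = (p == p' + d + e)%N by lia.
    case: ifP => [/andP[/eqP dT /eqP pE]|_]; last by rewrite mulr0.
    rewrite -scalerAl -scalerAr scalerA -mpolyXD; congr (_ *: _).
    rewrite mulrACA; congr (_ * _); rewrite -exprD; congr (c ^+ _).
    have h1 := cell_weight_drop sT (esym (subnK dp)) (card_cell x) pi.
    have h2 : (cell_weight T' p' + (~~ e) * t <= cell_weight (T :\ s) (p - d))%N.
      by rewrite -dT; apply: (cell_weight_drop (d := e) (N := i.+2) tT); [lia | exact: cD | lia].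
    exact: subn_chain.
  rewrite big1 // => t _; rewrite big1 // => e _; rewrite /E.
  (* First steps that leave the range contribute nothing: p = p' + d + e with p' <= i gives d <= p
     and p - d <= i + 1. *)
  case: ifP => // /andP[_ /eqP pE]; move: no pE; case: (d); case: (e) => /=; lia.
apply: antisym_sum => s t sT tT st; rewrite [X in - X]exchange_big /=.
rewrite -sumrN; apply: eq_bigr => d _; rewrite -sumrN; apply: eq_bigr => e _; rewrite /E.
have -> : T :\ t :\ s = T :\ s :\ t by rewrite !setDDl setUC.
have -> : (p' + e + d = p' + d + e)%N by rewrite addnAC.
case: ifP => _; last by rewrite oppr0.
by rewrite [(mon e t + _)%MM]addmC [(~~ e * t + _)%N]addnC (pos_signC _ sT tT st) mulNr scaleNr
  opprK.
Qed.

(** A 3 x 3 determinant with a repeated row vanishes. The targets of the first step have position 0,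
    so p fixes its letter: for p = 1 the sum is antisymmetric in the two indices carrying a, for p =
    0 in the two carrying b. *)
Lemma entry_mul_entry0 (x : cell 1) : \sum_(y : cell 0)
  diff_entry (cell_set x) (cell_pos x) (cell_set y) (cell_pos y) * minor_entry (cell_set y) = 0.
Proof.
rewrite (sum_entry x (fun T p => minor_entry T)).
set T := cell_set x; set p := cell_pos x.
have T3 : #|T| = 3%N by exact: card_cell.
have p1 : (p <= 1)%N := cell_pos_le x.
pose E d r s t : S := (pos_sign K T r * pos_sign K (T :\ r) s
      * c ^+ (cell_weight T p - (~~ d * r + t)))
    *: 'X_[mon d r + (mon true s + mon false t)].
transitivity (\sum_(r in T) \sum_(s in T :\ r) \sum_(t in T :\ r :\ s) E (p == 1) r s t).
  apply: eq_bigr => r rT; rewrite (bigD1 (p == 1)) //= [X in _ + X]big1 ?addr0; last first.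
    by move=> d; case: (p) p1 => [|[]] //; case: (d).
  have pE : p = (p == 1) :> nat by case: (p) p1 => [|[]].
  rewrite -pE leqnn subnn /= /minor_entry mulr_sumr; apply: eq_bigr => s sT.
  rewrite mulr_sumr; apply: eq_bigr => t tT.
  rewrite -scalerAl -scalerAr scalerA -mpolyXD; congr (_ *: _).
  rewrite mulrACA; congr (_ * _); rewrite -exprD; congr (c ^+ _).
  have h1 := @cell_weight_drop _ T r (p == 1) p 0 2 rT pE T3 p1.
  have : (t <= cell_weight (T :\ r) 0)%N.
    apply: mem_le_cell_weight; first by case/setD1P: tT.
    by have := cardsD1 r T; rewrite T3 rT add1n => -[<-].
  rewrite -[X in (X <= _)%N]add0n => h2.
  by have := subn_chain h1 h2; rewrite !subn0.
have Tmem r s t : r \in T -> s \in T -> t \in T -> r != s -> r != t -> s != t ->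
    T = [set r; s; t].
  move=> rT sT tT rs rt st; apply/esym/eqP; rewrite eqEcard T3; apply/andP; split.
    by apply/subsetP => y; rewrite !inE => /orP[/orP[]|] /eqP ->.
  by rewrite setUC cardsU1 cards2 !inE eq_sym (negPf rt) eq_sym (negPf st) rs.
case: (p == 1%N).
  apply: antisym_sum => r s rT sT rs; rewrite -sumrN.
  have -> : T :\ r :\ s = T :\ s :\ r by rewrite !setDDl setUC.
  apply: eq_bigr => t _; rewrite /E (pos_signC _ rT sT rs) mulNr scaleNr opprK.
  by congr (_ *: 'X_[_]); rewrite !addmA [(mon true s + _)%MM]addmC.
transitivity (\sum_(r in T) \sum_(t in T :\ r) \sum_(s in T :\ r :\ t) E false r s t).
  apply: eq_bigr => r rT; rewrite (exchange_big_dep (mem (T :\ r))) /=; last first.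
    by move=> s t _ /setD1P[].
  apply: eq_bigr => t tT; apply: eq_bigl => s; move: tT; rewrite !inE => ->.
  by rewrite andbT [t == s]eq_sym andbC.
apply: antisym_sum => r t rT tT rt; rewrite -sumrN.
have -> : T :\ r :\ t = T :\ t :\ r by rewrite !setDDl setUC.
apply: eq_bigr => s; rewrite !inE => /and3P[sr st sT]; rewrite /E.
rewrite (pos_signC3 K (Tmem _ _ _ rT sT tT _ rt st)) // 1?eq_sym // mulNr scaleNr opprK.
rewrite /= !mul1n [(t + r)%N]addnC; congr (_ *: 'X_[_]).
by rewrite [LHS]addmC [RHS]addmC -!addmA [(mon false t + _)%MM]addmC.
Qed.

End Differentials.

Section CellComplex.
Variables (K : fieldType) (n m : nat) (mon : bool -> 'I_m -> 'X_{1..n}) (c : K).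
Variable wt : 'X_{1..n} -> nat.
Hypothesis wtD : forall u v, wt (u + v)%MM = (wt u + wt v)%N.
Hypothesis wt_mon : forall d s, wt (mon d s) = (~~ d * s)%N.
Hypothesis mon_disj : forall x d s d' s',
  (0 < mon d s x)%N -> (0 < mon d' s' x)%N -> d = d' /\ s = s'.
Local Notation S := {mpoly K[n]}.
Implicit Types (T : {set 'I_m}) (s t : 'I_m) (d : bool) (p N : nat) (u v M : 'X_{1..n}).

Local Notation entry := (diff_entry mon c).
Local Notation entry0 := (minor_entry mon c).

(* The generator (T, p) lies over the monomial a_(t_0) ... a_(t_p) b_(t_(p+1)) ... b_(t_k),
   where t_0 < ... < t_k are the elements of T. *)
Definition lead_mon T p := (\sum_(s in T) mon (quota T p <= above T s)%N s)%MM.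
Definition mdegree u T p := (u + lead_mon T p)%MM.

Definition min_a M k := (mon true k <= M)%MM && [forall k', (mon true k' <= M)%MM ==> (k <= k')%N].
Definition max_b M k := (mon false k <= M)%MM && [forall k', (mon false k' <= M)%MM ==> (k' <=
  k)%N].
Definition has_min_a M T := [exists k in T, min_a M k].
Definition has_max_b M T := [exists k in T, max_b M k].
(* In multidegree M, let a be the least index with a_a | M and b the largest one with b_b | M.
   The matching toggles a in T, except when a is alone in its part, where it toggles b; the
   tie-break makes matched terms the leading ones within a weight and a multidegree. *)
Definition tie M T := (2 * ~~ has_min_a M T + ~~ has_max_b M T)%N.
(** [tie] is at most 3, so the factor 4 lets the weight decide first. *)
Definition cell_rank u T p := (4 * (wt u + cell_weight T p) + tie (mdegree u T p) T)%N.

Lemma min_a_le M a k : min_a M a -> (mon true k <= M)%MM -> (a <= k)%N.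
Proof. by case/andP => _ /forallP/(_ k)/implyP. Qed.

Lemma max_b_ge M b k : max_b M b -> (mon false k <= M)%MM -> (k <= b)%N.
Proof. by case/andP => _ /forallP/(_ k)/implyP. Qed.

Lemma min_a_inj M a b : min_a M a -> min_a M b -> a = b.
Proof.
move=> ha hb; apply/val_inj/anti_leq.
by rewrite (min_a_le ha) ?(min_a_le hb); [|case/andP: ha|case/andP: hb].
Qed.

Lemma max_b_inj M a b : max_b M a -> max_b M b -> a = b.
Proof.
move=> ha hb; apply/val_inj/anti_leq.
by rewrite (max_b_ge ha) ?(max_b_ge hb); [|case/andP: ha|case/andP: hb].
Qed.

Lemma min_a_ex M k : (mon true k <= M)%MM -> exists a, min_a M a.
Proof.
move=> hk; case: (arg_minnP (P := fun k => (mon true k <= M)%MM) val hk) => a ha hmin.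
by exists a; rewrite /min_a ha; apply/forallP => k'; apply/implyP => /hmin.
Qed.

Lemma max_b_ex M k : (mon false k <= M)%MM -> exists b, max_b M b.
Proof.
move=> hk; case: (arg_maxnP (P := fun k => (mon false k <= M)%MM) val hk) => b hb hmax.
by exists b; rewrite /max_b hb; apply/forallP => k'; apply/implyP => /hmax.
Qed.

Lemma has_min_aE M T a : min_a M a -> has_min_a M T = (a \in T).
Proof.
move=> ha; apply/existsP/idP => [[b /andP[bT hb]]|aT]; first by rewrite (min_a_inj ha hb).
by exists a; rewrite aT.
Qed.

Lemma has_max_bE M T b : max_b M b -> has_max_b M T = (b \in T).
Proof.
move=> hb; apply/existsP/idP => [[a /andP[aT ha]]|bT]; first by rewrite (max_b_inj hb ha).
by exists b; rewrite bT.
Qed.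

Lemma mon_le_mdegree u T p s : s \in T ->
  (mon (quota T p <= above T s)%N s <= mdegree u T p)%MM.
Proof.
move=> sT; rewrite /mdegree /lead_mon (big_setD1 s sT) /= addmA [(u + _)%MM]addmC -addmA.
exact: lem_addr.
Qed.

Section CardT.
Variables (T : {set 'I_m}) (p N : nat).
Hypotheses (cardT : #|T| = N.+1) (ltp : (p < N)%N).

Lemma quota_le : (quota T p <= N)%N.
Proof. by rewrite /quota cardT subSS leq_subr. Qed.

Lemma quota_gt0 : (0 < quota T p)%N.
Proof. by rewrite /quota cardT subSS subn_gt0. Qed.

Lemma above_min s : s \in T -> (forall t, t \in T -> (s <= t)%N) -> above T s = N.
Proof.
move=> sT smin; apply/eqP; rewrite -eqSS -nge_above // -cardT; apply/eqP/eq_card => t.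
by rewrite !inE; case: (boolP (t \in T)) => // /smin.
Qed.

Lemma above_max s : (forall t, t \in T -> (t <= s)%N) -> above T s = 0%N.
Proof.
move=> smax; apply/eqP; rewrite cards_eq0; apply/eqP/setP => t; rewrite !inE.
by apply/negP => /andP[/smax ts]; rewrite ltnNge ts.
Qed.

(** The smallest element of T always carries the letter a, since there are p + 1 > 0 of these. *)
Lemma min_a_cell u : exists a, [/\ min_a (mdegree u T p) a
  & forall s, s \in T -> (a <= s)%N].
Proof.
have [s0 s0T] : exists s, s \in T by apply/card_gt0P; rewrite cardT.
case: (arg_minnP val s0T) => s sT smin.
have le : (mon true s <= mdegree u T p)%MM.
  have := mon_le_mdegree u p sT; rewrite above_min // quota_le //.
have [a ha] := min_a_ex le; exists a; split=> // t tT.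
exact: leq_trans (min_a_le ha le) (smin _ tT).
Qed.

(** As p < N, at least one letter b remains, and the largest element of T carries it. *)
Lemma max_b_cell u : exists b, [/\ max_b (mdegree u T p) b
  & forall s, s \in T -> (s <= b)%N].
Proof.
have [s0 s0T] : exists s, s \in T by apply/card_gt0P; rewrite cardT.
case: (arg_maxnP val s0T) => s sT smax.
have le : (mon false s <= mdegree u T p)%MM.
  by have := mon_le_mdegree u p sT; rewrite above_max // leqNgt quota_gt0.
have [b hb] := max_b_ex le; exists b; split=> // t tT.
exact: leq_trans (smax _ tT) (max_b_ge hb le).
Qed.

Lemma lead_mon_drop s d p' : s \in T -> p = (p' + d)%N -> d = (quota T p <= above T s)%N ->
  lead_mon T p = (mon d s + lead_mon (T :\ s) p')%MM.
Proof.
move=> sT defp dE; rewrite /lead_mon (big_setD1 s sT) /= -dE; congr (_ + _)%MM.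
by apply: eq_bigr => t tT; rewrite (above_drop sT defp cardT ltp).
Qed.

Lemma mdegree_drop u s d p' : s \in T -> p = (p' + d)%N -> d = (quota T p <= above T s)%N ->
  mdegree (u + mon d s) (T :\ s) p' = mdegree u T p.
Proof. by move=> sT defp dE; rewrite /mdegree (lead_mon_drop sT defp dE) addmA. Qed.

Lemma weight_drop u s d p' : s \in T -> p = (p' + d)%N ->
  d = (quota T p <= above T s)%N \/
  (wt (u + mon d s) + cell_weight (T :\ s) p' < wt u + cell_weight T p)%N.
Proof.
move=> sT defp; have le := cell_weight_drop sT defp cardT ltp.
have [/eqP dE|nd] := boolP (d == (quota T p <= above T s)%N); [by left | right].
have := cell_weight_dropE sT defp cardT ltp; rewrite (negPf nd) wtD wt_mon => /negbT nE.
by rewrite -addnA ltn_add2l addnC ltn_neqAle nE le.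
Qed.

Lemma weight_eq u s d p' : s \in T -> p = (p' + d)%N -> d = (quota T p <= above T s)%N ->
  (wt (u + mon d s) + cell_weight (T :\ s) p' = wt u + cell_weight T p)%N.
Proof.
move=> sT defp dE; have := cell_weight_dropE sT defp cardT ltp.
by rewrite -dE eqxx wtD wt_mon -addnA [(~~ d * s + _)%N]addnC => /eqP ->.
Qed.
End CardT.

Lemma tie_le3 M T : (tie M T <= 3)%N.
Proof. by rewrite /tie; do 2 case: (~~ _). Qed.

Lemma rank_lt a b x y : (x < y)%N -> (a <= 3)%N -> (4 * x + a < 4 * y + b)%N.
Proof. lia. Qed.

Lemma msupp_entry T p T' p' v : v \in msupp (entry T p T' p') ->
  exists s d, [/\ s \in T, T' = T :\ s, p = (p' + d)%N & v = mon d s].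
Proof.
move/msupp_sum_le/flattenP => [A /mapP[s]]; rewrite mem_filter => /andP[sT _] ->.
move/msupp_sum_le/flattenP => [B /mapP[d _] ->].
case: ifP => [/andP[/eqP <- /eqP ->]|_]; last by rewrite msupp0.
by move/msuppZ_le; rewrite msuppX inE => /eqP ->; exists s, d.
Qed.

(** Source and target determine s and d, so an entry is a single term and nothing can cancel. *)
Lemma entryD1 T p s d p' : s \in T -> p = (p' + d)%N ->
  entry T p (T :\ s) p' = (pos_sign K T s
    * c ^+ (cell_weight T p - cell_weight (T :\ s) p' - ~~ d * s)) *: 'X_[mon d s].
Proof.
move=> sT defp; rewrite /diff_entry (bigD1 s) //= [X in _ + X]big1 ?addr0; last first.
  move=> t /andP[tT ts]; rewrite big1 // => e _; case: ifP => // /andP[/eqP/setP/(_ s)].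
  by rewrite !inE eqxx sT andbT eq_sym ts.
rewrite (bigD1 d) //= [X in _ + X]big1 ?addr0; first by rewrite eqxx defp eqxx.
move=> e ne; case: ifP => // /andP[_]; rewrite defp eqn_add2l => /eqP.
by move: ne; case: (d); case: (e).
Qed.

Lemma pos_sign_neq0 T s : pos_sign K T s != 0.
Proof. by rewrite /pos_sign signr_eq0. Qed.

(** * The complex and the leading terms of its differential *)

Definition cell_cx_rank i := if i is i'.+1 then #|{: cell m i'}| else 1%N.

Definition cell_cx_diff i : 'M[S]_(cell_cx_rank i.+1, cell_cx_rank i) :=
  match i with
  | 0 => \matrix_(k, k') entry0 (cell_set (enum_val k))
  | i'.+1 => \matrix_(k, k') entry (cell_set (enum_val k)) (cell_pos (enum_val k))
               (cell_set (enum_val k')) (cell_pos (enum_val k'))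
  end.

Lemma cell_cx_mul0 i : cell_cx_diff i.+1 *m cell_cx_diff i = 0.
Proof.
apply/matrixP => k k'; rewrite mxE [RHS]mxE; case: i k k' => [|i] k k' /=.
  rewrite -[RHS](entry_mul_entry0 mon c (enum_val k)) [RHS]big_enum_val /=.
  by apply: eq_bigr => j _; rewrite !mxE.
rewrite -[RHS](entry_mul0 mon c (enum_val k) (enum_val k')) [RHS]big_enum_val /=.
by apply: eq_bigr => j _; rewrite !mxE.
Qed.

Definition rho i : 'X_{1..n} -> 'I_(cell_cx_rank i) -> nat :=
  match i with
  | 0 => fun u _ => (4 * wt u)%N
  | i'.+1 => fun u k => cell_rank u (cell_set (enum_val k)) (cell_pos (enum_val k))
  end.

(** The chosen term keeps the weight, so its power of c is c ^ 0 and its coefficient is nonzero even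
    for c = 0. Every other term loses weight, or stays in the multidegree and is separated by
    [tie]. *)
Lemma leads_cell i (x : cell m i.+1) (y : cell m i) u s0 d0 :
  let T := cell_set x in let p := cell_pos x in
  s0 \in T -> d0 = (quota T p <= above T s0)%N -> cell_set y = T :\ s0 ->
  p = (cell_pos y + d0)%N ->
  (forall s d, s \in T -> s != s0 -> (d <= p)%N -> d = (quota T p <= above T s)%N ->
     tie (mdegree u T p) (T :\ s) < tie (mdegree u T p) (T :\ s0))%N ->
  leads (@rho i.+1) (cell_cx_diff i.+1) u (enum_rank x) (mon d0 s0) (enum_rank y).
Proof.
move=> T p s0T d0E yS yp htie; have pi : (p < i.+2)%N by rewrite ltnS; exact: cell_pos_le.
have cT : #|T| = i.+3 := card_cell x.
split.
  rewrite mcoeff_msupp mxE !enum_rankK yS (entryD1 s0T yp) mcoeffZ mcoeffX eqxx mulr1.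
  have /eqP := cell_weight_dropE s0T yp cT pi; rewrite -d0E eqxx => /eqP/eqP <-.
  by rewrite addKn subnn expr0 mulr1 pos_sign_neq0.
move=> v' k'; rewrite mxE enum_rankK => /msupp_entry[s [d [sT zS zp ->]]].
rewrite -[k']enum_valK /rho !enum_rankK; set z := enum_val k' in zS zp *.
rewrite /cell_rank yS (weight_eq cT pi u s0T yp d0E) (mdegree_drop cT pi u s0T yp d0E) zS.
case: (weight_drop cT pi u sT zp) => [dE|lt]; last first.
  by right; apply: rank_lt lt (tie_le3 _ _).
rewrite (weight_eq cT pi u sT zp dE) (mdegree_drop cT pi u sT zp dE).
have [es|ns] := eqVneq s s0; [left|right].
  have ed : d = d0 by rewrite dE d0E es.
  congr (_, _); first by rewrite ed es.
  congr (enum_rank _); apply: cell_inj; first by rewrite zS yS es.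
  by apply/eqP; rewrite -(eqn_add2r d0) -yp -ed -zp.
by rewrite ltn_add2l; apply: (htie s d) => //; rewrite /p zp leq_addl.
Qed.

Lemma min_a_mem_cell i (x : cell m i) u a :
  min_a (mdegree u (cell_set x) (cell_pos x)) a ->
  [/\ forall s, s \in cell_set x -> (a <= s)%N
    & a \in cell_set x -> above (cell_set x) a = i.+1].
Proof.
move=> ha; have pi : (cell_pos x < i.+1)%N by rewrite ltnS cell_pos_le.
have [a' [ha' amin]] := min_a_cell (cell_pos x) (card_cell x) u.
rewrite (min_a_inj ha ha'); split=> // a'T; exact: (above_min (card_cell x)).
Qed.

Lemma max_b_mem_cell i (x : cell m i) u b :
  max_b (mdegree u (cell_set x) (cell_pos x)) b ->
  [/\ forall s, s \in cell_set x -> (s <= b)%N & above (cell_set x) b = 0%N].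
Proof.
move=> hb; have pi : (cell_pos x < i.+1)%N by rewrite ltnS cell_pos_le.
have [b' [hb' bmax]] := max_b_cell (card_cell x) pi u.
by rewrite (max_b_inj hb hb'); split=> //; exact: above_max.
Qed.

Lemma cell_quota i (x : cell m i) : quota (cell_set x) (cell_pos x) = (i.+1 - cell_pos x)%N.
Proof. by rewrite /quota card_cell subSS. Qed.

(** Only the face without a has lost the least index, which contributes 2 to [tie]; on every other
    face the total is at most 1. *)
Lemma leads_min i (x : cell m i.+1) (y : cell m i) u a :
  min_a (mdegree u (cell_set x) (cell_pos x)) a -> a \in cell_set x ->
  cell_set y = cell_set x :\ a -> cell_pos x = (cell_pos y).+1 ->
  leads (@rho i.+1) (cell_cx_diff i.+1) u (enum_rank x) (mon true a) (enum_rank y).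
Proof.
move=> ha aT yS yp; have [amin /(_ aT) aa] := min_a_mem_cell ha.
apply: leads_cell => //; rewrite ?addn1 //.
  by rewrite cell_quota aa leq_subr.
move=> s d sT sa _ _; rewrite /tie !(has_min_aE _ ha) !inE eqxx aT andbT eq_sym sa /=.
by do 2 case: has_max_b.
Qed.

(** With p = 0 the index a is the only one carrying the letter a, and no such letter can be removed.
    All faces that keep the multidegree therefore contain a, and the missing b decides. *)
Lemma leads_max i (x : cell m i.+1) (y : cell m i) u a b :
  min_a (mdegree u (cell_set x) (cell_pos x)) a -> a \in cell_set x ->
  max_b (mdegree u (cell_set x) (cell_pos x)) b -> b \in cell_set x ->
  cell_set y = cell_set x :\ b -> cell_pos x = 0%N -> cell_pos y = 0%N ->
  leads (@rho i.+1) (cell_cx_diff i.+1) u (enum_rank x) (mon false b) (enum_rank y).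
Proof.
move=> ha aT hb bT yS xp yp; have [amin /(_ aT) aa] := min_a_mem_cell ha.
have [bmax ba] := max_b_mem_cell hb.
have neq : a != b by apply: contra_eq_neq ba => <-; rewrite aa.
apply: leads_cell => //; rewrite ?addn0 ?yp //.
  by rewrite cell_quota ba xp.
move=> s d sT sb dp dE.
have sa : s != a.
  apply: contraTneq dp => sa; rewrite dE sa aa cell_quota leq_subr xp //.
by rewrite /tie !(has_min_aE _ ha) !(has_max_bE _ hb) !inE eqxx aT bT neq !andbT eq_sym sa eq_sym
  sb.
Qed.

(** The letters have disjoint supports, so a letter of a column outside T divides no part of
    [lead_mon T p]. This allows a missing column to be moved from u into T. *)
Lemma mon_le_u u T p s d : s \notin T -> (mon d s <= mdegree u T p)%MM -> (mon d s <= u)%MM.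
Proof.
move=> sT /mnm_lepP le; apply/mnm_lepP => x; have := le x; rewrite mnmDE.
have [->|pos] := posnP (mon d s x); first by [].
rewrite /lead_mon mnm_sumE big1 ?addn0 // => t tT; apply/eqP; rewrite -leqn0 leqNgt.
by apply/negP => /(mon_disj pos)[_ e]; rewrite e tT in sT.
Qed.

(** * The matching of terms *)

Lemma rank_ord_eta i (k : 'I_(cell_cx_rank i.+1)) : exists x : cell m i, k = enum_rank x.
Proof. by exists (enum_val k); rewrite enum_valK. Qed.

(** Upward partners are obtained by inserting a, which raises p by one, or, when a is already
    present and p = 0, by inserting b, which keeps p. *)
Definition is_up i u (k : 'I_(cell_cx_rank i.+1)) : bool :=
  let T := cell_set (enum_val k) in let p := cell_pos (enum_val k) in
  let M := mdegree u T p in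
  ~~ has_min_a M T || ((p == 0)%N && ~~ has_max_b M T).

Lemma up_leads i u (k : 'I_(cell_cx_rank i.+1)) : is_up u k ->
  exists u' k' v, leads (@rho i.+1) (cell_cx_diff i.+1) u' k' v k /\ u = (u' + v)%MM.
Proof.
have [x ->] := rank_ord_eta k; rewrite /is_up enum_rankK.
set T := cell_set x; set p := cell_pos x; set M := mdegree u T p.
have pi : (p < i.+1)%N by rewrite ltnS cell_pos_le.
have [a [ha amin]] := min_a_cell (cell_pos x) (card_cell x) u.
have [b [hb bmax]] := max_b_cell (card_cell x) pi u.
rewrite (has_min_aE _ ha) (has_max_bE _ hb).
have [aT /= /andP[/eqP p0 bT]|aT _] := boolP (a \in T).
  have cT' : #|b |: T| = i.+3 by rewrite cardsU1 bT card_cell.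
  have [y [yS yp]] := cell_ex cT' (leq0n i.+1).
  have bu : (mon false b <= u)%MM := mon_le_u bT (proj1 (andP hb)).
  have dE : false = (quota (b |: T) 0 <= above (b |: T) b)%N.
    rewrite above_max => [|t]; last by rewrite !inE => /predU1P[->|/bmax].
    by rewrite /quota cT'.
  have bM : mdegree (u - mon false b) (cell_set y) (cell_pos y) = M.
    have := mdegree_drop cT' (ltn0Sn _) (u - mon false b) (setU11 b T) (erefl : 0%N = (0 +
      false)%N) dE.
    by rewrite setU1K // submK // yS yp /M p0 => <-.
  exists (u - mon false b)%MM, (enum_rank y), (mon false b); split; last by rewrite submK.
  by apply: (leads_max (a := a)); rewrite ?bM ?yS ?setU11 ?setU1r // setU1K.
exists (u - mon true a)%MM.
have cT' : #|a |: T| = i.+3 by rewrite cardsU1 aT card_cell.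
have [y [yS yp]] := cell_ex cT' (pi : (p.+1 <= i.+1)%N).
have au : (mon true a <= u)%MM := mon_le_u aT (proj1 (andP ha)).
have dE : true = (quota (a |: T) p.+1 <= above (a |: T) a)%N.
  rewrite (above_min cT') ?setU11 ?(quota_le _ cT') // => t.
  by rewrite !inE => /predU1P[->|/amin].
have bM : mdegree (u - mon true a) (cell_set y) (cell_pos y) = M.
  have := mdegree_drop cT' (pi : (p.+1 < i.+2)%N) (u - mon true a) (setU11 a T) (esym (addn1 p) :
    p.+1 = (p + true)%N) dE.
  by rewrite setU1K // submK // yS yp /M => <-.
exists (enum_rank y), (mon true a); split; last by rewrite submK.
by apply: leads_min; rewrite ?bM ?yS ?setU11 // setU1K.
Qed.

(** Keeping the multidegree M makes the match reversible, since M determines the indices a and b. In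
    the lowest degree the target monomial is M itself. *)
Definition down_rel i : 'X_{1..n} -> 'I_(cell_cx_rank i.+1) -> 'X_{1..n} ->
    'I_(cell_cx_rank i) -> Prop :=
  match i with
  | 0 => fun u k v _ => v = mdegree u (cell_set (enum_val k)) (cell_pos (enum_val k))
  | i'.+1 => fun u k v k0 =>
    let x := enum_val k in let y := enum_val k0 in
    let M := mdegree u (cell_set x) (cell_pos x) in
    mdegree v (cell_set y) (cell_pos y) = M /\
    if (cell_pos x == 0)%N then
      cell_pos y = 0%N /\
      exists b, [/\ max_b M b, b \in cell_set x & cell_set y = cell_set x :\ b]
    else cell_pos x = (cell_pos y).+1 /\
      exists a, [/\ min_a M a, a \in cell_set x & cell_set y = cell_set x :\ a]
  end.

Lemma is_upE i (x : cell m i) u a b :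
  let M := mdegree u (cell_set x) (cell_pos x) in
  min_a M a -> max_b M b -> ~~ is_up u (enum_rank x) ->
  a \in cell_set x /\ (cell_pos x = 0%N -> b \in cell_set x).
Proof.
move=> M ha hb; rewrite /is_up enum_rankK (has_min_aE _ ha) (has_max_bE _ hb).
by rewrite negb_or negbK => /andP[-> nb]; split=> // p0; move: nb; rewrite p0 eqxx negbK.
Qed.

Lemma down_leads i u (k : 'I_(cell_cx_rank i.+2)) : ~~ is_up u k ->
  exists v k0, leads (@rho i.+1) (cell_cx_diff i.+1) u k v k0 /\ down_rel u k (u + v)%MM k0.
Proof.
have [x ->] := rank_ord_eta k; rewrite /down_rel enum_rankK.
set T := cell_set x; set p := cell_pos x; set M := mdegree u T p => nup.
have pi : (p < i.+2)%N by rewrite ltnS cell_pos_le.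
have [a [ha amin]] := min_a_cell (cell_pos x) (card_cell x) u.
have [b [hb bmax]] := max_b_cell (card_cell x) pi u.
have [aT bT] := is_upE ha hb nup; have [_ /(_ aT) aa] := min_a_mem_cell ha.
have [_ ba] := max_b_mem_cell hb.
have card1 s : s \in T -> #|T :\ s| = i.+2.
  by move=> sT; have := cardsD1 s T; rewrite sT card_cell add1n => -[<-].
have [p0|pn0] := posnP p.
  have [y [yS yp]] := cell_ex (card1 _ (bT p0)) (leq0n i).
  exists (mon false b), (enum_rank y); rewrite enum_rankK; split.
    by apply: (leads_max (a := a)) => //; exact: bT.
  split; last by split=> //; exists b; split=> //; exact: bT.
  have dE : false = (quota T p <= above T b)%N by rewrite ba /T /p cell_quota -/p p0.
  by rewrite /M -(mdegree_drop (card_cell x) pi u (bT p0) (p' := 0%N) _ dE) ?yS ?yp ?p0.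
have pE : p = (p.-1 + true)%N by rewrite addn1 prednK.
have [|y [yS yp]] := cell_ex (card1 _ aT) (p := p.-1) _; first by rewrite -ltnS prednK.
exists (mon true a), (enum_rank y); rewrite enum_rankK yp prednK //.
split; first by apply: leads_min => //; rewrite yp prednK.
split; last by split=> //; exists a.
have dE : true = (quota T p <= above T a)%N by rewrite aa /T /p cell_quota leq_subr.
by rewrite /M -(mdegree_drop (card_cell x) pi u aT pE dE) ?yS ?yp.
Qed.

Lemma cell_term_inj i (x x' : cell m i) u u' : cell_set x = cell_set x' ->
  cell_pos x = cell_pos x' ->
  mdegree u (cell_set x) (cell_pos x) = mdegree u' (cell_set x') (cell_pos x') ->
  (u, enum_rank x) = (u', enum_rank x').
Proof.
by move=> eS ep; rewrite eS ep => /addIm ->; rewrite (cell_inj eS ep).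
Qed.

(** The target tells which index was removed: it still contains a exactly when b was. Inserting that
    index again recovers T and p. *)
Lemma down_rel_inj i u (k : 'I_(cell_cx_rank i.+2)) u' k' v k0 :
  ~~ is_up u k -> ~~ is_up u' k' -> down_rel u k v k0 -> down_rel u' k' v k0 ->
  (u, k) = (u', k').
Proof.
have [x ->] := rank_ord_eta k; have [x' ->] := rank_ord_eta k'.
rewrite /down_rel !enum_rankK; set y := enum_val k0.
move=> nup nup' [eM R] [eM' R']; set M := mdegree v _ _ in eM eM'.
have [a [ha _]] := min_a_cell (cell_pos x) (card_cell x) u.
have [b [hb _]] := max_b_cell (card_cell x) (cell_pos_le x : (_ < i.+2)%N) u.
have [ha' hb'] : min_a (mdegree u' (cell_set x') (cell_pos x')) a /\
    max_b (mdegree u' (cell_set x') (cell_pos x')) b by rewrite -eM' eM.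
have [aT bT] := is_upE ha hb nup; have [aT' bT'] := is_upE ha' hb' nup'.
have [_ /(_ aT) aa] := min_a_mem_cell ha; have [_ ba] := max_b_mem_cell hb.
have neq : a != b by apply: contra_eq_neq ba => <-; rewrite aa.
rewrite -eM in ha hb R; rewrite -eM' in ha' hb' R'.
have setE b0 : max_b M b0 -> b0 = b by move=> h0; exact: max_b_inj h0 hb.
have setE' a0 : min_a M a0 -> a0 = a by move=> h0; exact: min_a_inj h0 ha.
case: posnP R => [p0 [yp [b0 [/setE -> bS yS]]]|_ [yp [a0 [/setE' -> aS yS]]]];
case: posnP R' => [p0' [yp' [b1 [/setE -> bS' yS']]]|_ [yp' [a1 [/setE' -> aS' yS']]]].
- apply: cell_term_inj; rewrite -?eM -?eM' ?p0 ?p0' //.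
  by rewrite -(setD1K bS) -(setD1K bS') -yS -yS'.
- by have /setP/(_ a) := yS; rewrite yS' !inE eqxx aT neq.
- by have /setP/(_ a) := yS'; rewrite yS !inE eqxx aT' neq.
apply: cell_term_inj; rewrite -?eM -?eM' ?yp ?yp' //.
by rewrite -(setD1K aS) -(setD1K aS') -yS -yS'.
Qed.

Lemma pos_sign_min T s : (forall t, t \in T -> (s <= t)%N) -> pos_sign K T s = 1.
Proof.
move=> smin; rewrite /pos_sign (_ : [set t in T | _] = set0) ?cards0 ?expr0 //.
apply/setP => t; rewrite !inE; apply/negP => /andP[/smin st].
by rewrite ltnNge st.
Qed.

Lemma entry0_pair (a b : 'I_m) : (a < b)%N -> entry0 [set a; b] =
  'X_[mon true a + mon false b] - c ^+ (b - a) *: 'X_[mon true b + mon false a].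
Proof.
move=> ab; have nab : a != b by apply: contraTneq ab => ->; rewrite ltnn.
rewrite /minor_entry big_setU1 ?inE //= big_set1.
have -> : [set a; b] :\ a = [set b] by rewrite setU1K ?inE.
have -> : [set a; b] :\ b = [set a] by rewrite setUC setU1K // inE eq_sym.
rewrite !big_set1; have sa : pos_sign K [set a; b] a = 1.
  by apply: pos_sign_min => t; rewrite !inE => /orP[] /eqP -> //; exact: ltnW.
have -> : pos_sign K [set a; b] b = -1.
  by apply: oppr_inj; rewrite opprK -sa; apply/esym/pos_sign_pair.
rewrite (@cell_weight_pair _ _ b) ?cards2 ?nab ?inE ?eqxx ?orbT //; last first.
  by move=> t; rewrite !inE => /orP[] /eqP -> //; exact: ltnW.
by rewrite sa subnn expr0 mulr1 scale1r mulN1r scaleNr.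
Qed.

Lemma cell0_set (x : cell m 0) : exists a b : 'I_m, (a < b)%N /\ cell_set x = [set a; b].
Proof.
have /eqP/cards2P[a [b [nab ->]]] := card_cell x.
have [lt|gt|/val_inj e] := ltngtP a b; [by exists a, b | by exists b, a; rewrite setUC |].
by rewrite e eqxx in nab.
Qed.

Lemma cell0_pos (x : cell m 0) : cell_pos x = 0%N.
Proof. by apply/eqP; rewrite -leqn0 cell_pos_le. Qed.

Lemma down_leads0 u (k : 'I_(cell_cx_rank 1)) : ~~ is_up u k ->
  exists v k0, leads (@rho 0) (cell_cx_diff 0) u k v k0 /\ down_rel u k (u + v)%MM k0.
Proof.
have [x ->] := rank_ord_eta k; rewrite /down_rel enum_rankK => nup.
have [a [b [ab xS]]] := cell0_set x.
exists (mon true a + mon false b)%MM, 0.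
have nab : a != b by apply: contraTneq ab => ->; rewrite ltnn.
split; last first.
  rewrite /mdegree xS cell0_pos /lead_mon big_setU1 ?inE //= big_set1.
  have -> : quota [set a; b] 0 = 1%N by rewrite /quota cards2 nab.
  rewrite [above _ b]above_max => [|t]; last first.
    by rewrite !inE => /orP[] /eqP -> //; exact: ltnW.
  rewrite (@above_min _ 1) ?cards2 ?nab ?inE ?eqxx // => t.
  by rewrite !inE => /orP[] /eqP -> //; exact: ltnW.
have neq : (mon true b + mon false a == mon true a + mon false b)%MM = false.
  apply/eqP => /(congr1 wt); rewrite !wtD !wt_mon !mul0n !mul1n !add0n => e.
  by rewrite e ltnn in ab.
split.
  by rewrite mcoeff_msupp mxE enum_rankK xS entry0_pair // mcoeffB mcoeffZ !mcoeffX eqxx neq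
    mulr0 subr0 oner_eq0.
move=> v' k'; rewrite mxE enum_rankK xS entry0_pair // => /msuppB_le.
rewrite mem_cat msuppX inE => /orP[/eqP ->|/msuppZ_le]; first by left; rewrite (ord1 k').
rewrite msuppX inE => /eqP ->; right.
by rewrite /rho ltn_pmul2l // !wtD !wt_mon !mul0n !mul1n !add0n ltn_add2l.
Qed.

(** In the lowest degree an unmarked term has T = {a, b}, and both indices are read off the
    multidegree. *)
Lemma down_rel_inj0 u (k : 'I_(cell_cx_rank 1)) u' k' v k0 :
  ~~ is_up u k -> ~~ is_up u' k' -> down_rel u k v k0 -> down_rel u' k' v k0 ->
  (u, k) = (u', k').
Proof.
have [x ->] := rank_ord_eta k; have [x' ->] := rank_ord_eta k'.
rewrite /down_rel !enum_rankK => nup nup' -> eM.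
have [a [ha amin]] := min_a_cell (cell_pos x) (card_cell x) u.
have [b [hb bmax]] := max_b_cell (card_cell x) (cell_pos_le x : (_ < 1)%N) u.
have [ha' hb'] : min_a (mdegree u' (cell_set x') (cell_pos x')) a /\
    max_b (mdegree u' (cell_set x') (cell_pos x')) b by rewrite -eM.
have [aT /(_ (cell0_pos x)) bT] := is_upE ha hb nup.
have [aT' /(_ (cell0_pos x')) bT'] := is_upE ha' hb' nup'.
have [_ /(_ aT) aa] := min_a_mem_cell ha; have [_ ba] := max_b_mem_cell hb.
have neq : a != b by apply: contra_eq_neq ba => <-; rewrite aa.
have setE (z : cell m 0) : a \in cell_set z -> b \in cell_set z -> cell_set z = [set a; b].
  move=> az bz; apply/esym/eqP; rewrite eqEcard card_cell cards2 neq andbT.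
  by apply/subsetP => t; rewrite !inE => /orP[] /eqP ->.
have eS : cell_set x = cell_set x' by rewrite (setE x aT bT) (setE x' aT' bT').
have ep : cell_pos x = cell_pos x' by rewrite !cell0_pos.
exact: (@cell_term_inj 0 x x' u u' eS ep eM).
Qed.

Lemma cell_cx_exact i : exact_at (cell_cx_diff i.+1) (cell_cx_diff i).
Proof.
case: i => [|i].
  exact: (matching_exact (cell_cx_mul0 0) (@up_leads 0) down_leads0 down_rel_inj0).
exact: (matching_exact (cell_cx_mul0 i.+1) (@up_leads i.+1) (@down_leads i) (@down_rel_inj i)).
Qed.

End CellComplex.

(** * Resolutions and Betti numbers *)

Lemma mxrank_diag_pred (K : fieldType) r (P : pred 'I_r) :
  \rank (diag_mx (\row_k (P k)%:R) : 'M[K]_r) = #|P|.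
Proof.
pose E : 'M[K]_(#|P|, r) := \matrix_(i, k) (k == enum_val i)%:R.
have EE : E *m E^T = 1%:M.
  apply/matrixP => i j; rewrite !mxE (bigD1 (enum_val i)) //= big1 ?addr0 => [|k nk].
    by rewrite !mxE eqxx mul1r (inj_eq enum_val_inj).
  by rewrite !mxE (negPf nk) mul0r.
have dE : diag_mx (\row_k (P k)%:R) = E^T *m E.
  apply/matrixP => i j; rewrite !mxE.
  have [Pi|nPi] := boolP (i \in P); last first.
    rewrite -topredE /= in nPi; rewrite (negPf nPi) mul0rn big1 // => k _; rewrite !mxE.
    case: eqP => [e|]; last by rewrite mul0r.
    by have := enum_valP k; rewrite -e -topredE /= (negPf nPi).
  rewrite (bigD1 (enum_rank_in Pi i)) //= big1 ?addr0 => [|k nk].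
    rewrite !mxE enum_rankK_in // eqxx mul1r eq_sym.
    by rewrite -topredE /= in Pi; rewrite Pi.
  rewrite !mxE; case: eqP => [e|]; last by rewrite mul0r.
  by case/eqP: nk; apply: enum_val_inj; rewrite enum_rankK_in.
have rE : \rank E = #|P| by apply/eqP/row_freeP; exists E^T.
apply/eqP; rewrite eqn_leq -{1}rE dE mxrankS ?submxMl //=.
rewrite -{1}rE -{1}[E]mul1mx -EE -mulmxA mxrankS //; exact: submxMl.
Qed.

Section SortedTuples.
Variables (m : nat) (l : 'I_m -> nat).

Let ltm : rel 'I_m := fun a b => (a < b)%N.

Let ltm_trans : transitive ltm.
Proof. by move=> b a d; exact: ltn_trans. Qed.

Let ltm_irr : irreflexive ltm.
Proof. by move=> a; exact: ltnn. Qed.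

Lemma sorted_enum_set (A : {set 'I_m}) : sorted ltm (enum A).
Proof.
rewrite /enum_mem; apply: (sorted_filter ltm_trans); rewrite -enumT.
have := iota_ltn_sorted 0 m; rewrite -val_enum_ord sorted_map.
by apply: sub_sorted.
Qed.

Lemma card_Oset i j : #|Oset l i.+1 j| =
  #|[set x : {set 'I_m} * 'I_i.+1 | (#|x.1| == i.+2) && (\sum_(s in x.1) l s + x.2.+1 == j)%N]|.
Proof.
(* Increasing tuples correspond to their sets of entries, and r to p = r - 1. Excluding r = 0
   matters: it would collide with r = 1. *)
pose g (x : i.+2.-tuple 'I_m * 'I_i.+2) : {set 'I_m} * 'I_i.+1 :=
  ([set y in x.1], inord x.2.-1).
have g2 (x : i.+2.-tuple 'I_m * 'I_i.+2) : (1 <= x.2)%N -> (g x).2.+1 = x.2.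
  move=> x2; rewrite /g /= inordK ?prednK // -ltnS; exact: ltn_ord.
have tsum (t : i.+2.-tuple 'I_m) : sorted ltm t -> (\sum_(s in [set y in t]) l s = \sum_(k <- t)
  l k)%N.
  move=> st; rewrite big_uniq ?(sorted_uniq ltm_trans ltm_irr) //.
  by apply: eq_bigl => s; rewrite inE.
rewrite -(@card_in_imset _ _ g); last first.
  move=> [t r] [t' r']; rewrite !inE /= => /and3P[_ st r1] /and3P[_ st' r1'] e.
  have et : t = t'.
    apply/val_inj/(irr_sorted_eq ltm_trans ltm_irr st st') => y.
    by have /setP/(_ y) := congr1 fst e; rewrite !inE.
  congr (_, _) => //; apply/val_inj;
    have := congr1 (fun x : {set 'I_m} * 'I_i.+1 => (x.2 : nat).+1) e.
  by rewrite (g2 (t, r)) ?(g2 (t', r')).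
apply: eq_card => -[A p]; apply/imsetP/idP.
  case=> -[t r] tO e; move: tO; rewrite [_ \in Oset _ _ _]inE /= => /and3P[/eqP sj st r1].
  rewrite inE e.
  rewrite (g2 (t, r)) //= tsum // sj eqxx andbT cardsE (card_uniqP _) ?size_tuple //.
  exact: (sorted_uniq ltm_trans ltm_irr).
rewrite inE /= => /andP[/eqP cA /eqP sj].
have sz : size (enum A) == i.+2 by rewrite -cardE cA.
have pl : (p.+1 < i.+2)%N by rewrite ltnS.
have eA : [set y in Tuple sz] = A by apply/setP => y; rewrite inE mem_enum.
exists (Tuple sz, Ordinal pl).
  have := tsum (Tuple sz) (sorted_enum_set A); rewrite eA => eS.
  by rewrite inE /= sorted_enum_set andbT -eS sj.
by rewrite /g eA; congr (_, _); apply/val_inj; rewrite /= inordK.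
Qed.
End SortedTuples.

Section CellResolution.
Variables (K : fieldType) (n m : nat) (mon : bool -> 'I_m -> 'X_{1..n}) (c : K).
Variables (wt : 'X_{1..n} -> nat) (l : 'I_m -> nat).
Hypothesis wtD : forall u v, wt (u + v)%MM = (wt u + wt v)%N.
Hypothesis wt_mon : forall d s, wt (mon d s) = (~~ d * s)%N.
Hypothesis mon_disj : forall x d s d' s',
  (0 < mon d s x)%N -> (0 < mon d' s' x)%N -> d = d' /\ s = s'.
Hypothesis mdeg_mon : forall d s, mdeg (mon d s) = (l s + d)%N.
Hypothesis l_gt0 : forall s, (0 < l s)%N.
Local Notation S := {mpoly K[n]}.

Local Notation D := (@cell_cx_diff K n m mon c).

(** The degree of [lead_mon]: each column s contributes l s, and each of the p + 1 letters a one
    more. *)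
Definition cell_deg i : 'I_(cell_cx_rank m i) -> nat :=
  match i with
  | 0 => fun _ => 0%N
  | i'.+1 => fun k => (\sum_(s in cell_set (enum_val k)) l s + (cell_pos (enum_val k)).+1)%N
  end.

Definition cell_cx : free_complex K n := @FreeComplex K n _ cell_deg D (const_mx 1).

(** Taken as the image of [D 0], so exactness at the augmentation is immediate; the identification
    with the toric ideal for c = 1 and the initial ideal for c = 0 is a separate matter. *)
Definition cell_ideal (p : S) := exists w : 'rV_(cell_cx_rank m 1), p = (w *m D 0) 0 0.

Lemma mon_neq0 d s : mon d s != 0%MM.
Proof. by rewrite -mdeg_eq0 mdeg_mon -lt0n addn_gt0 l_gt0. Qed.

Lemma cell_diff_graded i : graded_mx (@cell_deg i.+1) (@cell_deg i) (D i).
Proof.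
case: i => [|i] k k' u; rewrite mxE /=.
  have [a [b [ab ->]]] := cell0_set (enum_val k).
  rewrite cell0_pos (entry0_pair _ _ ab) addn0.
  have nab : a != b by apply: contraTneq ab => ->; rewrite ltnn.
  rewrite big_setU1 ?inE //= big_set1 => /msuppB_le.
  rewrite mem_cat => /orP[|/msuppZ_le]; rewrite msuppX inE => /eqP ->.
    by rewrite mdegD !mdeg_mon addn0 addnAC.
  by rewrite mdegD !mdeg_mon addn0 addnAC [(l b + _)%N]addnC.
move/msupp_entry => [s [d [sT zS zp ->]]] /=.
rewrite mdeg_mon zS zp [in RHS](big_setD1 s sT) /= -!addnA; congr (_ + _)%N.
by rewrite addnCA !addnS [(d + _)%N]addnC.
Qed.

Lemma cell_diff_res0 i k k' : (D i k k')@_0%MM = 0.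
Proof.
apply/eqP; rewrite mcoeff_eq0; case: i k k' => [|i] k k'; rewrite mxE; apply/negP.
  have [a [b [ab ->]]] := cell0_set (enum_val k).
  rewrite (entry0_pair _ _ ab) => /msuppB_le.
  rewrite mem_cat => /orP[|/msuppZ_le]; rewrite msuppX inE eq_sym mnmD_eq0;
    by rewrite (negPf (mon_neq0 _ _)).
move/msupp_entry => [s [d [_ _ _ /esym/eqP]]].
by rewrite (negPf (mon_neq0 _ _)).
Qed.

Lemma cell_cx_resolution : graded_free_resolution cell_ideal cell_cx.
Proof.
have aug (w : 'rV[S]_1) : (w *m (const_mx 1 : 'cV[S]_1)) 0 0 = w 0 0.
  by rewrite mxE big_ord1 mxE mulr1.
split.
- split=> [k u|i k k' u].
    by rewrite mxE msupp1 inE => /eqP ->; rewrite mdeg0.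
  exact: cell_diff_graded.
- move=> p; exists (const_mx p); rewrite /= aug mxE subrr.
  by exists 0; rewrite mul0mx mxE.
- move=> w; rewrite /= aug; split=> -[w' e]; exists w'.
    by apply/rowP => k; rewrite (ord1 k) e.
  by rewrite e.
move=> i w; exact: (@cell_cx_exact K n m mon c wt wtD wt_mon mon_disj i w).
Qed.

Lemma cell_ideal_homog : homog_ideal cell_ideal.
Proof.
split.
- by exists 0; rewrite mul0mx mxE.
- move=> p q [w ->] [w' ->]; exists (w + w').
  by rewrite mulmxDl [RHS]mxE.
- move=> p q [w ->]; exists (p *: w).
  by rewrite -scalemxAl [RHS]mxE.
move=> r e p [w ->].
have gD : graded_mx (fun k => cell_deg k + e)%N (fun=> e) (D 0).
  move=> k k' u /cell_diff_graded /= <-; by rewrite addn0.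
exists (hcomp_mx (fun=> r) (fun k => cell_deg k + e)%N w).
by rewrite -(hcomp_mxM _ _ gD) [RHS]mxE.
Qed.

Lemma cell_cx_tor i j : tor_dim cell_cx i.+1 j = #|Oset l i.+1 j|.
Proof.
have R0 i' : residue_diff cell_cx i' = 0.
  by apply/matrixP => k k'; rewrite mxE [RHS]mxE; exact: cell_diff_res0.
rewrite /tor_dim /boundaries /cycles !R0 mulmx0 mxrank0 subn0.
rewrite (cap_eqmx (eqmx_refl _) (kermx0 _ _ _)) capmx1 /degree_part.
rewrite (mxrank_diag_pred _ (fun k => cell_deg k == j)) card_Oset.
set B := [set x | _]; set A := [set x : cell m i | val x \in B].
have -> : #|B| = #|A|.
  rewrite -(card_imset A val_inj); apply: eq_card => x; apply/idP/imsetP => [xB|[y + ->]].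
    have /andP[xc _] : (#|x.1| == i.+2) && (\sum_(s in x.1) l s + x.2.+1 == j)%N.
      by move: xB; rewrite inE.
    by exists (Sub x xc : cell m i); rewrite ?inE ?SubK // inE in xB *.
  by rewrite inE.
rewrite -!sum1_card big_mkcond [RHS]big_mkcond [RHS]big_enum_val /=.
apply: eq_bigr => k _; rewrite !inE -topredE /=.
by rewrite -/(cell_set (enum_val k)) -/(cell_pos (enum_val k)) card_cell eqxx.
Qed.

Lemma cell_ideal_betti i j : (0 < i)%N -> has_graded_betti cell_ideal i j #|Oset l i j|.
Proof.
case: i => // i _; split; first by exists cell_cx; exact: cell_cx_resolution.
move=> F hF; rewrite -cell_cx_tor.
exact: (tor_dim_unique cell_ideal_homog _ _ hF cell_cx_resolution).
Qed.

Lemma cell_ideal_minor (a b : 'I_m) : (a < b)%N ->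
  cell_ideal ('X_[mon true a + mon false b] - c ^+ (b - a) *: 'X_[mon true b + mon false a]).
Proof.
move=> ab; have [|x [xS _]] := @cell_ex m 0 [set a; b] 0 _ (leqnn 0).
  by rewrite cards2; case: eqVneq ab => // ->; rewrite ltnn.
exists (delta_mx 0 (enum_rank x)); rewrite -rowE !mxE enum_rankK xS.
by rewrite entry0_pair.
Qed.

Lemma cell_ideal_sub (I : S -> Prop) : I 0 -> (forall p q, I p -> I q -> I (p + q)) ->
  (forall p q, I q -> I (p * q)) ->
  (forall a b : 'I_m, (a < b)%N ->
     I ('X_[mon true a + mon false b] - c ^+ (b - a) *: 'X_[mon true b + mon false a])) ->
  forall p, cell_ideal p -> I p.
Proof.
move=> I0 ID IM Iab p [w ->]; rewrite mxE; elim/big_ind: _ => // k _; apply: IM.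
rewrite mxE; have [a [b [ab ->]]] := cell0_set (enum_val k).
by rewrite entry0_pair //; exact: Iab.
Qed.

End CellResolution.

(** * Normal forms *)

Section IdealSpan.
Variables (R : comNzRingType) (A : R -> Prop).

Lemma ideal_span0 : ideal_span A 0.
Proof. by exists [::]; rewrite big_nil. Qed.

Lemma ideal_spanD p q : ideal_span A p -> ideal_span A q -> ideal_span A (p + q).
Proof.
move=> [s [hs ->]] [t [ht ->]]; exists (s ++ t); rewrite big_cat; split=> // cg.
by rewrite mem_cat => /orP[/hs|/ht].
Qed.

Lemma ideal_spanM p q : ideal_span A q -> ideal_span A (p * q).
Proof.
move=> [s [hs ->]]; exists [seq (p * cg.1, cg.2) | cg <- s]; split.
  by move=> _ /mapP[cg cgs ->] /=; exact: hs cg cgs.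
by rewrite big_map mulr_sumr; apply: eq_bigr => cg _; rewrite mulrA.
Qed.

Lemma ideal_span_gen q : A q -> ideal_span A q.
Proof.
move=> Aq; exists [:: (1, q)]; rewrite big_seq1 mul1r; split=> // cg.
by rewrite inE => /eqP ->.
Qed.

Lemma ideal_span_min (I : R -> Prop) : I 0 -> (forall p q, I p -> I q -> I (p + q)) ->
  (forall p q, I q -> I (p * q)) -> (forall q, A q -> I q) ->
  forall p, ideal_span A p -> I p.
Proof.
move=> I0 ID IM IA p [s [hs ->]]; rewrite big_seq; elim/big_ind: _ => // cg /hs/IA.
exact: IM.
Qed.
End IdealSpan.

Lemma has_graded_betti_ext (K : fieldType) n (I J : {mpoly K[n]} -> Prop) i j b :
  (forall p, I p <-> J p) -> has_graded_betti I i j b -> has_graded_betti J i j b.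
Proof.
move=> IJ; have res (A B : {mpoly K[n]} -> Prop) F : (forall p, A p <-> B p) ->
    graded_free_resolution A F -> graded_free_resolution B F.
  move=> AB [h1 h2 h3 h4]; split=> //; first by move=> p; have [w /AB] := h2 p; exists w.
  by move=> w; rewrite -h3 AB.
by case=> -[F hF] h; split=> [|F' /res hF']; [exists F; exact: res hF | apply/h/hF' => p;
  rewrite IJ].
Qed.

Definition weight_order n (wt : 'X_{1..n} -> nat) : rel 'X_{1..n} :=
  fun u v => (wt u < wt v)%N || ((wt u == wt v) && (u <= v)%O).

Lemma weight_orderW n (wt : 'X_{1..n} -> nat) u v : weight_order wt u v -> (wt u <= wt v)%N.
Proof. by case/orP => [/ltnW|/andP[/eqP -> _]]. Qed.

Lemma weight_order_monomial n (wt : 'X_{1..n} -> nat) :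
  (forall u v, wt (u + v)%MM = (wt u + wt v)%N) -> monomial_order (weight_order wt).
Proof.
move=> wtD; rewrite /weight_order; split; [split|split].
- by move=> u; rewrite eqxx Order.POrderTheory.lexx orbT.
- move=> u v; case: ltngtP => //= _ /Order.POrderTheory.le_anti //.
- move=> v u w /orP[uv|/andP[/eqP -> uv]] /orP[vw|/andP[/eqP <- vw]].
  + by rewrite (ltn_trans uv vw).
  + by rewrite uv.
  + by rewrite vw.
  by rewrite eqxx (Order.POrderTheory.le_trans uv vw) orbT.
- move=> u v; case: ltngtP => //= _; exact: Order.TotalTheory.le_total.
- move=> u; have wt0 : wt 0%MM = 0%N by have := wtD 0%MM 0%MM; rewrite addm0; lia.
  by rewrite wt0 le0m andbT lt0n eq_sym orNb.
move=> u v w; rewrite !wtD ltn_add2r eqn_add2r => /orP[->//|/andP[-> uv]].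
by rewrite lemc_add2l uv orbT.
Qed.

Section Standard.
Variables (K : fieldType) (n m N : nat) (mon : bool -> 'I_m -> 'X_{1..n}).
Variables (wt : 'X_{1..n} -> nat) (phi : 'X_{1..n} -> 'X_{1..N}).
Variable (E : {mpoly K[n]} -> {mpoly K[N]}).
Hypothesis wtD : forall u v, wt (u + v)%MM = (wt u + wt v)%N.
Hypothesis wt_mon : forall d s, wt (mon d s) = (~~ d * s)%N.
Hypothesis mon_disj : forall x d s d' s',
  (0 < mon d s x)%N -> (0 < mon d' s' x)%N -> d = d' /\ s = s'.
Hypothesis mon_le1 : forall d s x, (mon d s x <= 1)%N.
Local Notation S := {mpoly K[n]}.

Definition standard (u : 'X_{1..n}) : bool :=
  [forall i : 'I_m, forall j : 'I_m, (i < j)%N ==> ~~ (mon true i + mon false j <= u)%MM].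

Hypothesis phi_mon : forall i j,
  phi (mon true i + mon false j)%MM = phi (mon true j + mon false i)%MM.
Hypothesis phi_inj : forall u v, standard u -> standard v -> phi u = phi v -> u = v.
Hypothesis ED : forall p q, E (p + q) = E p + E q.
Hypothesis EZ : forall a p, E (a *: p) = a *: E p.
Hypothesis EM : forall p q, E (p * q) = E p * E q.
Hypothesis EX : forall u, E 'X_[u] = 'X_[phi u].

Local Notation I1 := (@cell_ideal K n m mon 1).
Local Notation I0 := (@cell_ideal K n m mon 0).

Let E0 : E 0 = 0.
Proof. by rewrite -[0](scale0r 0) EZ scale0r. Qed.

Let I1z : I1 0. Proof. by exists 0; rewrite mul0mx mxE. Qed.
Let I1D p q : I1 p -> I1 q -> I1 (p + q).
Proof. by move=> [w ->] [w' ->]; exists (w + w'); rewrite mulmxDl [RHS]mxE. Qed.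
Let I1M p q : I1 q -> I1 (p * q).
Proof. by move=> [w ->]; exists (p *: w); rewrite -scalemxAl [RHS]mxE. Qed.
Let I0D p q : I0 p -> I0 q -> I0 (p + q).
Proof. by move=> [w ->] [w' ->]; exists (w + w'); rewrite mulmxDl [RHS]mxE. Qed.
Let I0M p q : I0 q -> I0 (p * q).
Proof. by move=> [w ->]; exists (p *: w); rewrite -scalemxAl [RHS]mxE. Qed.

Lemma cell_ideal1_sub_ker p : I1 p -> E p = 0.
Proof.
move: p; apply: cell_ideal_sub => // [p q ep eq|p q eq|i j ij].
- by rewrite ED ep eq addr0.
- by rewrite EM eq mulr0.
by rewrite expr1n scale1r -[- _]scaleN1r ED EZ !EX phi_mon scaleN1r subrr.
Qed.

Lemma nonstandardP u : ~~ standard u ->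
  exists i j : 'I_m, (i < j)%N /\ (mon true i + mon false j <= u)%MM.
Proof.
rewrite negb_forall => /existsP[i]; rewrite negb_forall => /existsP[j].
by rewrite negb_imply negbK => /andP[ij le]; exists i, j.
Qed.

(** Rewriting a_i b_j into a_j b_i for i < j lowers the weight by j - i, so it terminates. *)
Lemma normal_form u : exists v, [/\ standard v, I1 ('X_[u] - 'X_[v]) & v = u \/ (wt v < wt u)%N].
Proof.
have [k] := ubnP (wt u); elim: k => // k IH in u *; rewrite ltnS => leu.
have [su|/nonstandardP[i [j [ij le]]]] := boolP (standard u).
  by exists u; split; [|rewrite subrr|left].
pose w := (u - (mon true i + mon false j))%MM.
have uE : u = (w + (mon true i + mon false j))%MM by rewrite submK.
pose u' := (w + (mon true j + mon false i))%MM.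
have lt : (wt u' < wt u)%N.
  by rewrite uE /u' !wtD !wt_mon !mul0n !mul1n !add0n ltn_add2l.
have [v [sv Iv hv]] := IH u' (leq_trans lt leu).
exists v; split=> //; last by right; case: hv => [->|/ltn_trans]; last exact.
have -> : 'X_[u] - 'X_[v] = ('X_[u] - 'X_[u']) + ('X_[u'] - 'X_[v]) :> S.
  by rewrite addrA subrK.
apply: I1D => //; rewrite uE /u' !mpolyXD -mulrBr -!mpolyXD; apply: I1M.
by have := cell_ideal_minor mon (1 : K) ij; rewrite expr1n scale1r.
Qed.

(** [A] tracks the origin of the monomials of the normal form. Taken as the support of a polynomial
    without its leading monomial, it ensures that reduction does not recreate that monomial. *)
Lemma normal_form_poly (A : pred 'X_{1..n}) (p : S) : {subset msupp p <= A} ->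
  exists q, [/\ I1 (p - q), {subset msupp q <= standard}
    & forall w, w \in msupp q -> A w \/ exists2 v, A v & (wt w < wt v)%N].
Proof.
move=> hp; rewrite (mpolyE p) big_seq.
elim/big_ind: _ => [|p1 p2 [q1 [h1 s1 a1]] [q2 [h2 s2 a2]]|u up].
- by exists 0; split; rewrite ?subr0 // => w; rewrite msupp0.
- exists (q1 + q2); rewrite opprD addrACA; split; first exact: I1D.
    by move=> w /msuppD_le; rewrite mem_cat => /orP[/s1|/s2].
  by move=> w /msuppD_le; rewrite mem_cat => /orP[/a1|/a2].
have [v [sv Iv hv]] := normal_form u; exists (p@_u *: 'X_[v]).
split; first by rewrite -scalerBr -mul_mpolyC; exact: I1M.
  by move=> w /msuppZ_le; rewrite msuppX inE => /eqP ->.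
move=> w /msuppZ_le; rewrite msuppX inE => /eqP ->.
by case: hv => [->|lt]; [left; exact: hp | right; exists u => //; exact: hp].
Qed.

Lemma standard_ker0 (q : S) : {subset msupp q <= standard} -> E q = 0 -> q = 0.
Proof.
move=> sq Eq; apply/mpolyP => u; rewrite mcoeff0; apply/eqP; rewrite mcoeff_eq0.
apply/negP => uq; have /eqP := congr1 (mcoeff (phi u)) Eq; rewrite mcoeff0 => /eqP.
have -> : E q = \sum_(v <- msupp q) q@_v *: 'X_[phi v].
  rewrite {1}(mpolyE q); elim: (msupp q) => [|v s IH]; first by rewrite !big_nil.
  by rewrite !big_cons ED IH EZ EX.
rewrite raddf_sum /= (bigD1_seq u) ?msupp_uniq //= big_seq_cond big1 ?addr0.
  by rewrite mcoeffZ mcoeffX eqxx mulr1 => /eqP; rewrite mcoeff_eq0 uq.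
move=> v /andP[vq vu]; rewrite mcoeffZ mcoeffX; case: eqP => [e|]; last by rewrite mulr0.
by case/eqP: vu; apply: phi_inj => //; [exact: sq | exact: sq].
Qed.

Lemma ker_cell_ideal p : E p = 0 <-> I1 p.
Proof.
split=> [Ep|]; last exact: cell_ideal1_sub_ker.
have [q [Iq sq _]] := @normal_form_poly predT p (fun _ _ => isT).
suff q0 : q = 0 by move: Iq; rewrite q0 subr0.
apply: standard_ker0 => //.
have := cell_ideal1_sub_ker Iq; rewrite -[- q]scaleN1r ED EZ Ep add0r scaleN1r.
by move/eqP; rewrite oppr_eq0 => /eqP.
Qed.

(** If u were standard, reducing the other terms of p would give a kernel element with standard
    support in which u keeps its nonzero coefficient. *)
Lemma lead_nonstandard p u : E p = 0 -> is_lead_monomial (weight_order wt) p u -> ~~ standard u.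
Proof.
move=> Ep [up lead]; apply/negP => su.
pose p' := p - p@_u *: 'X_[u]; pose A : pred 'X_{1..n} := [pred v | (v \in msupp p) && (v != u)].
have hp' : {subset msupp p' <= A}.
  move=> v; rewrite mcoeff_msupp mcoeffB mcoeffZ mcoeffX inE /= mcoeff_msupp.
  have [->|vu] := eqVneq v u; first by rewrite mulr1 subrr eqxx.
  by rewrite mulr0 subr0 andbT.
have [q [Iq sq hq]] := normal_form_poly hp'.
have uq : u \notin msupp q.
  apply/negP => /hq[/andP[_]|[v /andP[/lead/weight_orderW le _]]]; first by rewrite eqxx.
  by rewrite ltnNge le.
have Eq : E (p@_u *: 'X_[u] + q) = 0.
  have := cell_ideal1_sub_ker Iq; rewrite /p' => e.
  have : E (p - (p@_u *: 'X_[u] + q)) = 0 by rewrite opprD addrA.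
  rewrite -[- (_ + _)]scaleN1r ED EZ Ep add0r scaleN1r => /eqP.
  by rewrite oppr_eq0 => /eqP.
have : (p@_u *: 'X_[u] + q) = 0.
  apply: standard_ker0 Eq => v /msuppD_le; rewrite mem_cat => /orP[|/sq //].
  by move/msuppZ_le; rewrite msuppX inE => /eqP ->.
move/(congr1 (mcoeff u)); rewrite mcoeffD mcoeffZ mcoeffX eqxx mulr1 mcoeff0.
rewrite (memN_msupp_eq0 uq) addr0 => /eqP.
by rewrite mcoeff_eq0 up.
Qed.

Lemma cell_ideal0_mon (i j : 'I_m) u : (i < j)%N -> (mon true i + mon false j <= u)%MM ->
  I0 'X_[u].
Proof.
move=> ij /submK <-; rewrite mpolyXD; apply: I0M.
by have := cell_ideal_minor mon (0 : K) ij; rewrite expr0n subn_eq0 leqNgt ij /= scale0r subr0.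
Qed.

Lemma minor_lead (i j : 'I_m) : (i < j)%N ->
  let p : S := 'X_[mon true i + mon false j] - 'X_[mon true j + mon false i] in
  E p = 0 /\ is_lead_monomial (weight_order wt) p (mon true i + mon false j)%MM.
Proof.
move=> ij p; have neq : (mon true j + mon false i == mon true i + mon false j)%MM = false.
  apply/eqP => /(congr1 wt); rewrite !wtD !wt_mon !mul0n !mul1n !add0n => e.
  by rewrite e ltnn in ij.
split.
  by rewrite /p -[- _]scaleN1r ED EZ !EX phi_mon scaleN1r subrr.
split.
  by rewrite mcoeff_msupp mcoeffB !mcoeffX eqxx neq subr0 oner_eq0.
move=> v /msuppB_le; rewrite mem_cat !msuppX !inE => /orP[] /eqP ->.
  by rewrite /weight_order eqxx Order.POrderTheory.lexx orbT.
by rewrite /weight_order !wtD !wt_mon !mul0n !mul1n !add0n ij.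
Qed.

Let B (u : 'X_{1..n}) := exists i j : 'I_m, (i < j)%N /\ u = (mon true i + mon false j)%MM.

Lemma initial_cell_ideal p : initial_ideal (weight_order wt) (fun p => E p = 0) p <-> I0 p.
Proof.
split.
  apply: ideal_span_min => //; first by exists 0; rewrite mul0mx mxE.
  move=> q [p1 [u [Ep /(lead_nonstandard Ep)/nonstandardP[i [j [ij le]]] ->]]].
  exact: cell_ideal0_mon ij le.
move: p; apply: cell_ideal_sub; [exact: ideal_span0|exact: ideal_spanD|exact: ideal_spanM|].
move=> i j ij; rewrite expr0n subn_eq0 leqNgt ij /= scale0r subr0.
have [Ep lead] := minor_lead ij; apply: ideal_span_gen.
by eexists; eexists; split; [exact: Ep | exact: lead | ].
Qed.

Lemma cell_ideal0_span p : I0 p <-> ideal_span (fun q => exists2 u, B u & q = 'X_[u]) p.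
Proof.
split.
  move: p; apply: cell_ideal_sub; [exact: ideal_span0|exact: ideal_spanD|exact: ideal_spanM|].
  move=> i j ij; rewrite expr0n subn_eq0 leqNgt ij /= scale0r subr0.
  by apply: ideal_span_gen; eexists; [exists i, j; split; first exact: ij|].
apply: ideal_span_min => //; first by exists 0; rewrite mul0mx mxE.
by move=> q [u [i [j [ij ->]]] ->]; apply: (cell_ideal0_mon ij); exact: lepm_refl.
Qed.

Lemma initial_squarefree :
  squarefree_monomial_ideal (initial_ideal (weight_order wt) (fun p => E p = 0)).
Proof.
exists B; split; last by move=> p; rewrite initial_cell_ideal cell_ideal0_span.
move=> u [i [j [ij ->]]] x; rewrite mnmDE.
have [->|pos] := posnP (mon true i x); first by rewrite add0n mon_le1.
have [->|pos'] := posnP (mon false j x); first by rewrite addn0 mon_le1.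
by case: (mon_disj pos pos').
Qed.

End Standard.

(** * The multi-path graph *)

Section MultiPathEdges.
Variables (m : nat) (l : 'I_m -> nat).
Hypothesis hl : forall k : 'I_m, (1 <= l k)%N.
Local Notation G := (multipath l).
Local Notation n := #|edges G|.
Local Notation walk := (@mpath_walk m l).
Local Open Scope nat_scope.

(** Codes live in a nondependent type, so vertices of different paths are compared without transport
    along equalities of indices. *)
Definition vertex_code (x : mpath_vertex l) : option 'I_m * nat :=
  match x with
  | inl false => (None, 0)
  | inl true => (None, 1)
  | inr u => (Some (tag u), (tagged u).+1)
  end.

Lemma code_walk k t : vertex_code (walk k t) =
  if t == 0 then (None, 0) else if t <= (l k).*2 then (Some k, t) else (None, 1).
Proof. by case: t => //= t; case: insubP => [s lt <-|/negPf ->] //=; rewrite ltn_ord. Qed.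

Local Arguments mpath_walk : simpl never.

Lemma walk_eq k t k' t' : t <= (l k).*2.+1 -> t' <= (l k').*2.+1 -> walk k t = walk k' t' ->
  [\/ t = 0 /\ t' = 0, [/\ 0 < t, t <= (l k).*2, k = k' & t = t']
    | t = (l k).*2.+1 /\ t' = (l k').*2.+1].
Proof.
move=> lt lt' /(congr1 vertex_code); rewrite !code_walk.
case: (posnP t) => [->|t0]; case: (posnP t') => [->|t0'].
- by constructor 1.
- by case: ifP.
- by case: ifP.
case: leqP => h; case: leqP => h' //.
  by case=> -> ->; constructor 2.
by move=> _; constructor 3; split; apply/eqP; rewrite eqn_leq ?lt ?lt'.
Qed.

Lemma walk_eqE k t t' : t <= (l k).*2.+1 -> t' <= (l k).*2.+1 ->
  (walk k t == walk k t') = (t == t').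
Proof.
move=> lt lt'; apply/eqP/eqP => [|-> //] /(walk_eq lt lt')[[-> ->]|[_ _ _ ->]|[-> ->]] //.
Qed.

Definition path_edge k t : {set mpath_vertex l} := [set walk k t; walk k t.+1].

Lemma path_edge_inj k t k' t' : t <= (l k).*2 -> t' <= (l k').*2 ->
  path_edge k t = path_edge k' t' -> k = k' /\ t = t'.
Proof.
move=> lt lt' e.
have sub x : x \in path_edge k t -> x = walk k' t' \/ x = walk k' t'.+1.
  by rewrite e !inE => /orP[] /eqP; [left|right].
have h0 : walk k t = walk k' t' \/ walk k t = walk k' t'.+1 by apply: sub; rewrite !inE eqxx.
have h1 : walk k t.+1 = walk k' t' \/ walk k t.+1 = walk k' t'.+1.
  by apply: sub; rewrite !inE eqxx orbT.
(* Paths of length at least 3 have no edge joining the two ends, the only edge that two paths could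
   share. *)
have hk := hl k; have hk' := hl k'.
have lS : t <= (l k).*2.+1 := leqW lt; have lS' : t' <= (l k').*2.+1 := leqW lt'.
have lt1 : t.+1 <= (l k).*2.+1 by []; have lt1' : t'.+1 <= (l k').*2.+1 by [].
case: h0 => e0; case: h1 => e1.
- case: (walk_eq lS lS' e0) => [[a b]|[a b ek et]|[a b]];
  case: (walk_eq lt1 lS' e1) => [[a' b']|[a' b' ek' et']|[a' b']]; try lia.
- case: (walk_eq lS lS' e0) => [[a b]|[a b ek et]|[a b]];
  case: (walk_eq lt1 lt1' e1) => [[a' b']|[a' b' ek' et']|[a' b']]; try lia; by split=> //; lia.
- case: (walk_eq lS lt1' e0) => [[a b]|[a b ek et]|[a b]];
  case: (walk_eq lt1 lS' e1) => [[a' b']|[a' b' ek' et']|[a' b']]; try lia.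
- case: (walk_eq lS lt1' e0) => [[a b]|[a b ek et]|[a b]];
  case: (walk_eq lt1 lt1' e1) => [[a' b']|[a' b' ek' et']|[a' b']]; try lia.
Qed.

Definition path_step := {k : 'I_m & 'I_(l k).*2.+1}.
Definition step_edge (e : path_step) : {set vertex G} := path_edge (tag e) (tagged e).

Lemma step_edge_inj : injective step_edge.
Proof.
move=> [k t] [k' t'] e; have [/= ek] := path_edge_inj (ltn_ord t) (ltn_ord t') e.
by move: t t' {e}; rewrite /= ek => t t' /val_inj ->.
Qed.

Lemma edgesP (E : {set vertex G}) : reflect (exists e, E = step_edge e) (E \in edges G).
Proof.
apply: (iffP imsetP) => [[[x y] /=]|[[k t] ->]].
  rewrite inE /= => /existsP[k /existsP[t xy]] ->.
  case/orP: xy => /andP[/eqP -> /eqP ->].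
    by exists (Tagged (fun k : 'I_m => 'I_(l k).*2.+1) t).
  by exists (Tagged (fun k : 'I_m => 'I_(l k).*2.+1) t); rewrite setUC.
exists (walk k t, walk k t.+1) => //; rewrite inE; apply/existsP; exists k.
by apply/existsP; exists t; rewrite !eqxx.
Qed.

Lemma step_edge_in e : step_edge e \in edges G.
Proof. by apply/edgesP; exists e. Qed.

Definition edge_index e : 'I_n := enum_rank_in (step_edge_in e) (step_edge e).

Lemma enum_edge_index e : enum_val (edge_index e) = step_edge e.
Proof. by rewrite enum_rankK_in ?step_edge_in. Qed.

Lemma edge_step_ex (x : 'I_n) : exists e, edge_index e == x.
Proof.
have /edgesP[e xe] := enum_valP x; exists e; apply/eqP/enum_val_inj.
by rewrite enum_edge_index.
Qed.

Definition edge_step (x : 'I_n) : path_step := xchoose (edge_step_ex x).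

Lemma edge_stepK : cancel edge_step edge_index.
Proof. by move=> x; apply/eqP; exact: (xchooseP (edge_step_ex x)). Qed.

Lemma edge_indexK : cancel edge_index edge_step.
Proof.
by move=> e; apply: step_edge_inj; rewrite -enum_edge_index edge_stepK enum_edge_index.
Qed.

Definition tstep k (t : 'I_(l k).*2.+1) : path_step := Tagged (fun k => 'I_(l k).*2.+1) t.

Lemma sum_edges (F : 'I_n -> nat) :
  \sum_x F x = \sum_k \sum_(t < (l k).*2.+1) F (edge_index (tstep t)).
Proof.
rewrite (reindex edge_index) /=; last first.
  by exists edge_step => x _; [exact: edge_indexK | exact: edge_stepK].
rewrite (sig_big_dep _ _ (fun k t => F (edge_index (@tstep k t)))) /=.
by apply: eq_bigr => -[k t] _.
Qed.

(* The product of the edges of path k at even positions (d = true) or odd positions (d =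
   false). *)
Definition path_mon (d : bool) (k : 'I_m) : 'X_{1..n} :=
  [multinom ((tag (edge_step x) == k) && (odd (tagged (edge_step x)) == ~~ d) : nat) | x < n].

Lemma path_monE d k k' (t : 'I_(l k').*2.+1) :
  path_mon d k (edge_index (tstep t)) = (k' == k) && (odd t == ~~ d).
Proof. by rewrite mnmE edge_indexK. Qed.

Lemma sum_path_mon d k (F : 'I_n -> nat) : \sum_x path_mon d k x * F x =
  \sum_(t < (l k).*2.+1) (odd t == ~~ d) * F (edge_index (tstep t)).
Proof.
rewrite sum_edges (bigD1 k) //= [X in _ + X]big1 ?addn0 => [|k' nk].
  by apply: eq_bigr => t _; rewrite path_monE eqxx.
by rewrite big1 // => t _; rewrite path_monE (negPf nk).
Qed.

Lemma path_mon_disj x d s d' s' :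
  0 < path_mon d s x -> 0 < path_mon d' s' x -> d = d' /\ s = s'.
Proof.
rewrite !mnmE !lt0b => /andP[/eqP <- /eqP e] /andP[/eqP <- /eqP e']; split=> //.
by apply: negb_inj; rewrite -e -e'.
Qed.

Lemma path_mon_le1 d s x : path_mon d s x <= 1.
Proof. by rewrite mnmE leq_b1. Qed.

Lemma mdeg_path_mon d s : mdeg (path_mon d s) = l s + d.
Proof.
rewrite mdegE; transitivity (\sum_x path_mon d s x * 1).
  by apply: eq_bigr => x _; rewrite muln1.
rewrite (sum_path_mon d s (fun=> 1)); elim: (l s) => [|k IH].
  by rewrite big_ord_recr big_ord0 /=; case: (d).
rewrite doubleS !big_ord_recr /= in IH *; rewrite IH /= negbK odd_double.
by case: (d) => /=; lia.
Qed.

(* The second edge of path k has weight k and the other edges weight 0, so that b_k has weight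
   k and a_k has weight 0. *)
Definition path_weight (u : 'X_{1..n}) : nat :=
  \sum_x u x * ((tagged (edge_step x) == 1 :> nat) * tag (edge_step x)).

Lemma path_weightD u v : path_weight (u + v)%MM = path_weight u + path_weight v.
Proof. by rewrite -big_split; apply: eq_bigr => x _; rewrite mnmDE mulnDl. Qed.

Lemma path_weight_mon d s : path_weight (path_mon d s) = ~~ d * s.
Proof.
rewrite /path_weight (sum_path_mon d s (fun x => (tagged (edge_step x) == 1 :> nat) * tag
  (edge_step x))).
have h1 : 1 < (l s).*2.+1 by have := hl s; lia.
rewrite (bigD1 (Ordinal h1)) //= edge_indexK /= mul1n big1 ?addn0 => [|t nt].
  by case: (d).
by rewrite edge_indexK /= -(inj_eq val_inj) in nt *; rewrite (negPf nt) mul0n muln0.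
Qed.

(** * The toric map on exponent vectors *)

Definition edge_exp (u : 'X_{1..n}) : 'X_{1..#|vertex G|} :=
  [multinom \sum_x u x * (enum_val y \in (enum_val x : {set vertex G})) | y < #|vertex G|].

Lemma edge_expD u v : edge_exp (u + v)%MM = (edge_exp u + edge_exp v)%MM.
Proof.
apply/mnmP => y; rewrite mnmDE !mnmE -big_split.
by apply: eq_bigr => x _; rewrite mnmDE mulnDl.
Qed.

Lemma mem_path_edge k (t : 'I_(l k).*2.+1) v :
  (v \in path_edge k t) = (v == walk k t) + (v == walk k t.+1) :> nat.
Proof.
rewrite !inE; case: (eqVneq v (walk k t)) => [->|_] //=.
by rewrite (negPf (mpath_walk_neq t)).
Qed.

(** Even edges cover every vertex of the path once, odd edges every inner vertex once; only the two
    ends differ. *)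
Lemma sum_even_odd (f : nat -> nat) L :
  \sum_(t < L.*2.+1) (odd t == false) * (f t + f t.+1) =
  \sum_(t < L.*2.+1) (odd t == true) * (f t + f t.+1) + f 0 + f L.*2.+1.
Proof.
elim: L => [|L IH]; first by rewrite double0 !big_ord_recr !big_ord0 /=; lia.
rewrite doubleS !(big_ord_recr _.+2) /= !(big_ord_recr _.+1) /=.
rewrite IH /= odd_double !eqbF_neg !eqb_id /=; lia.
Qed.

Lemma edge_exp_mon d k y : edge_exp (path_mon d k) y =
  \sum_(t < (l k).*2.+1) (odd t == ~~ d) * ((enum_val y == walk k t) + (enum_val y == walk k t.+1)).
Proof.
rewrite mnmE (sum_path_mon d k (fun x => (enum_val y \in (enum_val x : {set vertex G})) : nat)).
by apply: eq_bigr => t _; rewrite enum_edge_index [X in _ * X]mem_path_edge.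
Qed.

Lemma edge_exp_swap i j : edge_exp (path_mon true i + path_mon false j)%MM =
  edge_exp (path_mon true j + path_mon false i)%MM.
Proof.
rewrite !edge_expD; apply/mnmP => y; rewrite !mnmDE !edge_exp_mon.
rewrite !(sum_even_odd (fun t => enum_val y == walk _ t)); cbv beta.
have e k : walk k (l k).*2.+1 = mpath_end l by rewrite /mpath_walk insubF // ltnn.
have e0 k : walk k 0 = mpath_start l by [].
by rewrite !e !e0; ring.
Qed.

(** Positions are natural numbers, so that induction along a path is possible; [inord] returns a
    default beyond its last edge. *)
Definition step_exp (u : 'X_{1..n}) k t := u (edge_index (tstep (inord t : 'I_(l k).*2.+1))).

Lemma edge_expE u v : edge_exp u (enum_rank v) =
  \sum_k \sum_(t < (l k).*2.+1) step_exp u k t * ((v == walk k t) + (v == walk k t.+1)).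
Proof.
rewrite mnmE enum_rankK sum_edges; apply: eq_bigr => k _; apply: eq_bigr => t _.
by rewrite enum_edge_index [X in _ * X]mem_path_edge /step_exp inord_val.
Qed.

Lemma edge_exp_start u : edge_exp u (enum_rank (mpath_start l)) = \sum_k step_exp u k 0.
Proof.
rewrite edge_expE; apply: eq_bigr => k _.
have ne t : (mpath_start l == walk k t.+1) = false.
  by apply/eqP => /(congr1 vertex_code); rewrite (code_walk k t.+1) /=; case: ifP.
have e0 : (mpath_start l == walk k 0) = true by exact: eqxx.
rewrite (bigD1 ord0) // big1 => [|t nt]; first by rewrite (ne 0) e0 /= addn0 muln1.
by case: t nt => -[|t] lt //= _; rewrite (ne t) (ne t.+1) muln0.
Qed.

Lemma edge_exp_inner u k t : t < (l k).*2 ->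
  edge_exp u (enum_rank (walk k t.+1)) = step_exp u k t + step_exp u k t.+1.
Proof.
move=> lt; rewrite edge_expE (bigD1 k) //= [X in _ + X]big1 ?addn0 => [|k' nk]; last first.
  have ne t' : t' <= (l k').*2.+1 -> (walk k t.+1 == walk k' t') = false.
    move=> lt'; apply/eqP => /(walk_eq (leqW lt) lt')[[]//|[_ _ e]|[[e] _]].
      by rewrite e eqxx in nk.
    by move: lt; rewrite e ltnn.
  by rewrite big1 // => t' _; rewrite (ne t' (ltnW (ltn_ord t'))) (ne t'.+1 (ltn_ord t')) muln0.
have e t' : t' <= (l k).*2.+1 -> (walk k t.+1 == walk k t') = (t' == t.+1).
  by move=> lt'; rewrite walk_eqE 1?eq_sym //; exact: leqW.
have lt0 : t < (l k).*2.+1 := leqW lt.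
have lt1 : t.+1 < (l k).*2.+1 by [].
rewrite (bigD1 (Ordinal lt0)) //= (bigD1 (Ordinal lt1)) /=; last first.
  by rewrite -(inj_eq val_inj) /= eqn_leq ltnn.
rewrite (e t (ltnW lt0)) (e t.+1 lt0) (e t.+2 lt1) !eqxx [X in _ + (_ + X)]big1 ?addn0 => [|t'
  /andP[n0 n1]].
  by rewrite ltn_eqF // gtn_eqF // !muln1.
rewrite -!(inj_eq val_inj) /= in n0 n1.
by rewrite (e t' (ltnW (ltn_ord t'))) (e t'.+1 (ltn_ord t')) (negPf n1) eqSS (negPf n0) muln0.
Qed.

Lemma alternating_eq (a b : nat -> nat) L : (forall t, t < L -> a t + a t.+1 = b t + b t.+1) ->
  a 0 = b 0 -> forall t, t <= L -> a t = b t.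
Proof.
move=> h h0; elim=> // t IH lt; have := h t lt; have := IH (ltnW lt); lia.
Qed.

(** Equal sums at the inner vertices make the difference of a and b change sign at every step. *)
Lemma alternating_lt (a b : nat -> nat) L : (forall t, t < L -> a t + a t.+1 = b t + b t.+1) ->
  a 0 < b 0 -> forall t, t <= L -> if odd t then b t < a t else a t < b t.
Proof.
move=> h h0; elim=> // t IH lt; have := h t lt; have := IH (ltnW lt) => /=.
by case: odd => /=; lia.
Qed.

Lemma path_mon_le d k u : (forall t, t <= (l k).*2 -> odd t == ~~ d -> 0 < step_exp u k t) ->
  (path_mon d k <= u)%MM.
Proof.
move=> h; apply/mnm_lepP => x; rewrite -(edge_stepK x); case: (edge_step x) => k' t.
rewrite -/(tstep t) path_monE; case: eqP => [e|] //=; case: eqP => //= od.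
move: t od; rewrite e => t od; have := h t; rewrite /step_exp inord_val; apply.
  by rewrite -ltnS.
exact/eqP.
Qed.

Lemma path_mon_pair_le i j u : (path_mon true i <= u)%MM -> (path_mon false j <= u)%MM ->
  (path_mon true i + path_mon false j <= u)%MM.
Proof.
move=> /mnm_lepP hi /mnm_lepP hj; apply/mnm_lepP => x; rewrite mnmDE.
have [->|pos] := posnP (path_mon true i x); first exact: hj.
have [->|pos'] := posnP (path_mon false j x); first by rewrite addn0.
by case: (path_mon_disj pos pos').
Qed.

Lemma sum_lt_ex (a b : 'I_m -> nat) i : \sum_k a k = \sum_k b k -> a i < b i ->
  exists j, b j < a j.
Proof.
move=> e lt; apply/existsP; apply: contraTT isT => /existsPn h.
suff : \sum_k a k < \sum_k b k by rewrite e ltnn.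
rewrite (bigD1 i) //= [ltnRHS](bigD1 i) //= -addSn leq_add //.
by apply: leq_sum => k _; rewrite leqNgt h.
Qed.

(** Suppose u is smaller than v on the first edge of path i. Equality at the starting vertex gives a
    path j where it is larger. By alternation a_i and b_j divide v, while a_j and b_i divide u. So v
    is not standard if i < j, and u is not if j < i. Hence u and v agree on all first edges, and the
    inner vertices propagate this along each path. *)
Lemma edge_exp_inj u v : standard path_mon u -> standard path_mon v ->
  edge_exp u = edge_exp v -> u = v.
Proof.
have inner u' v' k : edge_exp u' = edge_exp v' -> forall t, t < (l k).*2 ->
    step_exp u' k t + step_exp u' k t.+1 = step_exp v' k t + step_exp v' k t.+1.
  by move=> e t lt; rewrite -!edge_exp_inner // e.
have key u' v' i : standard path_mon u' -> standard path_mon v' -> edge_exp u' = edge_exp v' ->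
    ~~ (step_exp u' i 0 < step_exp v' i 0).
  move=> su sv e; apply/negP => lti.
  have [j ltj] : exists j, step_exp v' j 0 < step_exp u' j 0.
    by apply: (sum_lt_ex (i := i)) => //; rewrite -!edge_exp_start e.
  have hi := alternating_lt (inner _ _ i e) lti.
  have hj := alternating_lt (inner _ _ j (esym e)) ltj.
  have ai : (path_mon true i <= v')%MM.
    by apply: path_mon_le => t /hi; case: odd => // h _; exact: leq_ltn_trans h.
  have bi : (path_mon false i <= u')%MM.
    by apply: path_mon_le => t /hi; case: odd => // h _; exact: leq_ltn_trans h.
  have aj : (path_mon true j <= u')%MM.
    by apply: path_mon_le => t /hj; case: odd => // h _; exact: leq_ltn_trans h.
  have bj : (path_mon false j <= v')%MM.
    by apply: path_mon_le => t /hj; case: odd => // h _; exact: leq_ltn_trans h.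
  have [ij|ji|/val_inj ij] := ltngtP i j.
  - move: sv => /forallP/(_ i)/forallP/(_ j)/implyP/(_ ij).
    by rewrite path_mon_pair_le.
  - move: su => /forallP/(_ j)/forallP/(_ i)/implyP/(_ ji).
    by rewrite path_mon_pair_le.
  by move: lti; rewrite ij => /(ltn_trans ltj); rewrite ltnn.
move=> su sv e; apply/mnmP => x; rewrite -(edge_stepK x); case: (edge_step x) => k t.
rewrite -/(tstep t); have e0 : step_exp u k 0 = step_exp v k 0.
  have h1 := key u v k su sv e; have h2 := key v u k sv su (esym e).
  by apply/eqP; rewrite eqn_leq [X in X && _]leqNgt h2 leqNgt h1.
have := alternating_eq (inner _ _ k e) e0 (t := t).
by rewrite /step_exp inord_val; apply; rewrite -ltnS.
Qed.

End MultiPathEdges.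

Lemma edge_mapX (K : fieldType) m (l : 'I_m -> nat) u :
  edge_map ('X_[u] : {mpoly K[#|edges (multipath l)|]}) = 'X_[edge_exp u].
Proof.
rewrite /edge_map comp_mpolyX.
under eq_bigr => e _ do rewrite tnth_mktuple mprodXE mpolyXn.
rewrite mprodXE; congr 'X_[_]; apply/mnmP => y; rewrite mnm_sumE mnmE.
apply: eq_bigr => e _; rewrite mulmnE mulnC mnm_sumE; congr (_ * _)%N.
have [ye|ny] := boolP (enum_val y \in _).
  rewrite (bigD1 (enum_val y)) //= mnm1E enum_valK eqxx big1 ?addn0 // => x /andP[_ nx].
  by rewrite mnm1E -(inj_eq enum_val_inj) enum_rankK (negPf nx).
rewrite big1 // => x xe; rewrite mnm1E; case: eqP => // yx; move: ny.
by rewrite -yx enum_rankK xe.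
Qed.

Theorem corollary4p10 (K : fieldType) (m : nat) (l : 'I_m -> nat)
    (hm : (2 <= m)%N) (hl : forall k : 'I_m, (1 <= l k)%N) :
  exists lem : rel 'X_{1..#|edges (multipath l)|},
    [/\ monomial_order lem,
        squarefree_monomial_ideal
          (initial_ideal lem (@toric_ideal K (multipath l)))
      & forall i j : nat, (1 <= i)%N -> (1 <= j)%N ->
          has_graded_betti (@toric_ideal K (multipath l)) i j #|Oset l i j| /\
          has_graded_betti
            (initial_ideal lem (@toric_ideal K (multipath l)))
            i j #|Oset l i j|].
Proof.
pose wt := @path_weight m l; pose mon := @path_mon m l.
have wtD : forall u v, wt (u + v)%MM = (wt u + wt v)%N := @path_weightD m l.
have wt_mon : forall d s, wt (mon d s) = (~~ d * s)%N := @path_weight_mon m l hl.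
pose E := @edge_map K (multipath l).
have ED p q : E (p + q) = E p + E q by exact: comp_mpolyD.
have EZ a p : E (a *: p) = a *: E p by exact: comp_mpolyZ.
have EM p q : E (p * q) = E p * E q by exact: rmorphM.
have EX u : E 'X_[u] = 'X_[edge_exp u] by exact: edge_mapX.
exists (weight_order wt); split.
- exact: weight_order_monomial.
- exact: (initial_squarefree wtD wt_mon (@path_mon_disj m l) (@path_mon_le1 m l)
    (@edge_exp_swap m l hl) (@edge_exp_inj m l hl) ED EZ EM EX).
move=> i j i1 _; split.
  apply: has_graded_betti_ext (cell_ideal_betti 1 wtD wt_mon (@path_mon_disj m l)
    (@mdeg_path_mon m l hl) hl j i1) => p; apply: iff_sym.
  exact: (ker_cell_ideal wtD wt_mon (@edge_exp_swap m l hl) (@edge_exp_inj m l hl) ED EZ EM EX).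
apply: has_graded_betti_ext (cell_ideal_betti 0 wtD wt_mon (@path_mon_disj m l)
    (@mdeg_path_mon m l hl) hl j i1) => p; apply: iff_sym.
exact: (initial_cell_ideal wtD wt_mon (@edge_exp_swap m l hl) (@edge_exp_inj m l hl) ED EZ EM EX).
Qed.
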